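(* Suppose the Banach algebra $A$ is approximately semi-amenable. Then $A$ has a left approximate identity and a right approximate identity. Moreover, if $J$ is a closed two-sided ideal of $A$ which has a bounded approximate identity, then $J$ is approximately semi-amenable.
   Context: A left (right) approximate identity of $A$ is a net $(e_\alpha)$ in $A$ with $e_\alpha a\to a$ (resp. $ae_\alpha\to a$) for all $a\in A$; no boundedness is required. For a Banach algebra $B$ and Banach $B$-bimodule $X$, $X^*$ is a Banach $B$-bimodule via $\langle b\cdot f,x\rangle=\langle f,x\cdot b\rangle$, $\langle f\cdot b,x\rangle=\langle f,b\cdot x\rangle$; a derivation is a linear $D:B\to X^*$ with $D(bc)=b\cdot D(c)+D(b)\cdot c$; it is approximately semi-inner if there are nets $(\xi_i),(\eta_i)$ in $X^*$ with $D(b)=\lim_i(b\cdot\xi_i-\eta_i\cdot b)$ in norm for every $b\in B$. $B$ is approximately semi-amenable if for every Banach $B$-bimodule $X$ every continuous derivation $B\to X^*$ is approximately semi-inner. *)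

(* Defs.v *)
From HB Require Import structures.
From mathcomp Require Import all_boot all_order all_algebra.
From mathcomp Require Import all_classical all_reals all_analysis.
From mathcomp Require Import complex.
Set Implicit Arguments.
Unset Strict Implicit.
Unset Printing Implicit Defensive.
Import Order.TTheory GRing.Theory Num.Theory.
Import numFieldNormedType.Exports.
Local Open Scope ring_scope.
Local Open Scope classical_set_scope.

Record dirset := DirSet {
  dI :> Type;
  dle : dI -> dI -> Prop;
  dle_refl : forall i, dle i i;
  dle_trans : forall i j k, dle i j -> dle j k -> dle i k;
  dle_dir : forall i j, exists k, dle i k /\ dle j k;
  dI_inh : inhabited dI }.

Definition eventually (N : dirset) (P : dI N -> Prop) : Prop :=
  exists i0 : dI N, forall i, dle i0 i -> P i.

Section BanachAlg.
Variable R : realType.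
Local Notation K := (R[i]).

Variable A : completeNormedModType K.
Variable mul : A -> A -> A.

Definition banach_algebra : Prop :=
  [/\ (forall a b c, mul (mul a b) c = mul a (mul b c)),
      (forall a b c, mul (a + b) c = mul a c + mul b c),
      (forall a b c, mul a (b + c) = mul a b + mul a c),
      (forall (k : K) a b, mul (k *: a) b = k *: mul a b /\ mul a (k *: b) = k *: mul a b)
    & (forall a b, `|mul a b| <= `|a| * `|b|)].

Definition closed_ideal (J : set A) : Prop :=
  [/\ closed J, J 0,
      (forall a b, J a -> J b -> J (a + b)),
      (forall (k : K) a, J a -> J (k *: a))
    & (forall a j, J j -> J (mul a j) /\ J (mul j a))].

(* The subalgebra S (S = setT for A itself, S = J for an ideal) regarded as a
   Banach algebra with the restricted operations and norm.  A Banach S-bimodule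
   is a Banach space X with actions whose values are only constrained for
   elements of S. *)
Section Module.
Variable S : set A.
Variable X : completeNormedModType K.
Variable lact : A -> X -> X.
Variable ract : X -> A -> X.

Definition banach_bimodule : Prop :=
  [/\ (forall a x y, S a -> lact a (x + y) = lact a x + lact a y
                        /\ ract (x + y) a = ract x a + ract y a),
      (forall a b x, S a -> S b -> lact (a + b) x = lact a x + lact b x
                                 /\ ract x (a + b) = ract x a + ract x b),
      (forall (k : K) a x, S a ->
          [/\ lact (k *: a) x = k *: lact a x, lact a (k *: x) = k *: lact a x,
              ract x (k *: a) = k *: ract x a & ract (k *: x) a = k *: ract x a]),
      (forall a b x, S a -> S b ->
          [/\ lact (mul a b) x = lact a (lact b x),
              ract x (mul a b) = ract (ract x a) b
            & ract (lact a x) b = lact a (ract x b)])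
    & (exists M : K, forall a x, S a ->
          `|lact a x| <= M * `|a| * `|x| /\ `|ract x a| <= M * `|a| * `|x|)].

Definition dual_elt (f : X -> K) : Prop :=
  [/\ (forall x y, f (x + y) = f x + f y),
      (forall (k : K) x, f (k *: x) = k * f x)
    & (exists M : K, forall x, `|f x| <= M * `|x|)].

Definition dual_lact (b : A) (f : X -> K) : X -> K := fun x => f (ract x b).
Definition dual_ract (f : X -> K) (b : A) : X -> K := fun x => f (lact b x).

Definition cont_derivation (D : A -> X -> K) : Prop :=
  [/\ (forall a, S a -> dual_elt (D a)),
      (forall a b x, S a -> S b -> D (a + b) x = D a x + D b x),
      (forall (k : K) a x, S a -> D (k *: a) x = k * D a x),
      (forall a b x, S a -> S b ->
          D (mul a b) x = dual_lact a (D b) x + dual_ract (D a) b x)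
    & (exists M : K, forall a x, S a -> `|D a x| <= M * `|a| * `|x|)].

(* Approximately semi-inner: D(b) = lim_i (b.xi_i - eta_i.b) in the norm of X^*,
   i.e. for every eps > 0, eventually || D(b) - (b.xi_i - eta_i.b) || <= eps. *)
Definition approx_semi_inner (D : A -> X -> K) : Prop :=
  exists (N : dirset) (xi eta : dI N -> X -> K),
    (forall i, dual_elt (xi i) /\ dual_elt (eta i)) /\
    forall b, S b -> forall eps : K, 0 < eps ->
      eventually (fun i => forall x,
        `|D b x - (dual_lact b (xi i) x - dual_ract (eta i) b x)| <= eps * `|x|).
End Module.

Definition approx_semi_amenable (S : set A) : Prop :=
  forall (X : completeNormedModType K) (lact : A -> X -> X) (ract : X -> A -> X),
    banach_bimodule S lact ract ->
    forall D : A -> X -> K, cont_derivation S lact ract D ->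
      approx_semi_inner S lact ract D.

Definition has_left_approx_identity (S : set A) : Prop :=
  exists (N : dirset) (e : dI N -> A), (forall i, S (e i)) /\
    forall a, S a -> forall eps : K, 0 < eps ->
      eventually (fun i => `|mul (e i) a - a| < eps).

Definition has_right_approx_identity (S : set A) : Prop :=
  exists (N : dirset) (e : dI N -> A), (forall i, S (e i)) /\
    forall a, S a -> forall eps : K, 0 < eps ->
      eventually (fun i => `|mul a (e i) - a| < eps).

Definition has_bounded_approx_identity (S : set A) : Prop :=
  exists (N : dirset) (e : dI N -> A) (M : K),
    (forall i, S (e i) /\ `|e i| <= M) /\
    forall a, S a -> forall eps : K, 0 < eps ->
      eventually (fun i => `|mul (e i) a - a| < eps /\ `|mul a (e i) - a| < eps).

End BanachAlg.

(* Main.v *)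
Require Import Defs.
From HB Require Import structures.
From mathcomp Require Import all_boot all_order all_algebra.
From mathcomp Require Import all_classical all_reals all_analysis.
From mathcomp Require Import complex ring lra.
Set Implicit Arguments.
Unset Strict Implicit.
Unset Printing Implicit Defensive.
Import Order.TTheory GRing.Theory Num.Theory.
Import numFieldNormedType.Exports.
Local Open Scope ring_scope.
Local Open Scope classical_set_scope.

(** Approximate identities: make [A^*] a bimodule with [(a . f) x = f (x a)] and
    zero right action; the canonical map [A -> A^**] is then a derivation, so
    there are [E_i] in [A^**] with [E_i . a -> a] in norm.  If no [e] satisfied
    [|e a - a| < eps] on a finite set, Hahn-Banach would separate [(a)_a] from
    [{(e a)_a}] by functionals [f_a]; then [sum_a a . f_a = 0] although
    [sum_a f_a a <> 0], contradicting [E_i . a -> a].  The right-hand case is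
    the left-hand one for the opposite algebra.

    Ideals: given a [J]-bimodule [X] and a derivation [D : J -> X^*], let [T] be
    the Banach space of [J]-balanced bounded trilinear forms on [J * X * J] (the
    dual of [J (x)_J X (x)_J J]).  [A] acts on [T] through the two copies of [J],
    and [delta_a (j, x, k) = D (k a) (j x) - D k (a j x)] defines a derivation of
    [A] into [T], hence into the bidual of [T].  Approximate it by
    [xi_i], [eta_i] in the dual of [T^*], and pull back along the nearly
    [J]-linear maps [x |-> e (x) x (x) e] from [X] to [T^*], with [e] running
    through the bounded approximate identity.  The discrepancy between [D b] and
    [e . D b . e] is semi-inner up to a small error, by the derivation identity. *)

Local Open Scope complex_scope.

(** * Complex numbers *)

Section ComplexNumbers.
Variable R : realType.
Local Notation K := R[i].

Lemma norm_real_complex (r : R) : `|r%:C| = `|r|%:C :> K.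
Proof. by rewrite normc_def/= expr0n addr0 sqrtr_sqr. Qed.

Lemma real_complexD (x y : R) : (x + y)%:C = x%:C + y%:C :> K.
Proof. exact: rmorphD. Qed.

Lemma real_complexM (x y : R) : (x * y)%:C = x%:C * y%:C :> K.
Proof. exact: rmorphM. Qed.

Lemma RRe_ge0 (x : K) : 0 <= x -> (complex.Re x)%:C = x.
Proof. by move=> /ger0_real /RRe_real. Qed.

Lemma RRe_norm (V : normedZmodType K) (x : V) : (complex.Re `|x|)%:C = `|x|.
Proof. by rewrite RRe_ge0. Qed.

Lemma Re_ge0 (x : K) : 0 <= x -> 0 <= complex.Re x.
Proof. by rewrite lecE => /andP[]. Qed.

Lemma Re_le (x y : K) : x <= y -> complex.Re x <= complex.Re y.
Proof. by rewrite lecE => /andP[]. Qed.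

Lemma normc_ge_Im (x : K) : `|complex.Im x|%:C <= `|x|.
Proof.
by rewrite normc_def lecR -sqrtr_sqr ler_wsqrtr// lerDr sqr_ge0.
Qed.

Lemma normc_le_ReIm (x : K) :
  `|x| <= `|complex.Re x|%:C + `|complex.Im x|%:C.
Proof.
rewrite {1}[x]complexE (le_trans (ler_normD _ _))// normrM.
rewrite !norm_real_complex.
suff -> : `|'i%C| = 1 :> K by rewrite mul1r.
by rewrite normc_def/= expr0n add0r expr1n sqrtr1.
Qed.

(** Both coordinates are 1-Lipschitz, so they carry the filter to Cauchy filters on [R]; the two
    real limits are then reassembled. *)
Lemma complex_cauchy_cvg (F : set_system K) : ProperFilter F ->
  (forall e : R, 0 < e -> exists x, F [set y | `|x - y| < e%:C]) ->
  exists l : K, forall e : R, 0 < e -> F [set y | `|l - y| < e%:C].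
Proof.
move=> FF Fc.
have part (h : K -> R) : (forall x y, `|h x - h y|%:C <= `|x - y|) ->
    exists l : R, forall e : R, 0 < e -> F [set y | `|l - h y| < e].
  move=> hle.
  have : cvg (h @ F).
    apply: cauchy_cvg; apply: cauchy_exP => e e0.
    have [x Fx] := Fc e e0; exists (h x).
    rewrite /nbhs/=; apply: filterS Fx => y /= xy.
    by rewrite /ball/= -ltcR (le_lt_trans (hle _ _)).
  move=> /cvg_ex [l hl]; exists l => e e0.
  by move/cvgrPdist_lt: hl => /(_ e e0).
have [|a ha] := part (@complex.Re R).
  by move=> [x x'] [y y']; exact: (normc_ge_Re (x +i* x' - y +i* y')).
have [|b hb] := part (@complex.Im R).
  by move=> [x x'] [y y']; exact: (normc_ge_Im (x +i* x' - y +i* y')).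
exists (a +i* b) => e e0.
have e20 : 0 < e / 2 by rewrite divr_gt0.
apply: filterS2 (ha _ e20) (hb _ e20) => -[x y] /= h1 h2.
rewrite (le_lt_trans (normc_le_ReIm _))//= -rmorphD ltcR.
by rewrite [e]splitr ltrD.
Qed.

End ComplexNumbers.

(** * Banach spaces of functions with linear constraints *)

Section ConstrainedFunctions.
Variable R : realType.
Local Notation K := R[i].
Variables (T : Type) (u : T -> K) (C : T -> T -> K -> T -> Prop).

(* Linear constraints [F t = F t1 + s * F t2] survive pointwise limits, so every
   choice of [u] and [C] gives a Banach space; duals and spaces of balanced
   multilinear forms are both of this shape. *)
Definition cfun_pred : {pred T -> K} := [pred F : T -> K | `[<
  (forall t t1 s t2, C t t1 s t2 -> F t = F t1 + s * F t2) /\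
  exists M : K, forall t, `|F t| <= M * `|u t| >]].

(* A bound by [M * x] with [x >= 0] forces [M * x] to be real, although [M]
   need not be. *)
Lemma ge0_bound (M x y : K) : 0 <= x -> `|y| <= M * x -> `|y| <= `|M| * x.
Proof.
move=> x0 h; have -> : `|M| * x = `|M * x| by rewrite normrM (ger0_norm x0).
by rewrite [leRHS]ger0_norm// (le_trans _ h).
Qed.

Lemma cfun_submod_closed : submod_closed cfun_pred.
Proof.
split.
  apply/asboolP; split; first by move=> *; rewrite /= mulr0 addr0.
  by exists 0 => t; rewrite normr0 mul0r.
move=> k F G /asboolP[FC [M FM]] /asboolP[GC [N GN]].
apply/asboolP; split.
  move=> t t1 s t2 Ct; rewrite !fctE (FC _ _ _ _ Ct) (GC _ _ _ _ Ct).
  by rewrite /GRing.scale /=; ring.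
exists (`|k| * `|M| + `|N|) => t; rewrite mulrDl.
rewrite (le_trans (ler_normD _ _))// lerD ?ge0_bound// normrM -mulrA.
by rewrite ler_wpM2l// ge0_bound.
Qed.

HB.instance Definition _ :=
  GRing.isSubmodClosed.Build K (T -> K) cfun_pred cfun_submod_closed.

Record cfun := CFun { cfun_val :> T -> K; _ : cfun_val \in cfun_pred }.

HB.instance Definition _ := [isSub for cfun_val].
HB.instance Definition _ := [Choice of cfun by <:].
HB.instance Definition _ := [SubChoice_isSubLmodule of cfun by <:].

Implicit Types F G : cfun.

Lemma cfunP F G : F =1 G -> F = G.
Proof. by move=> FG; apply: val_inj; apply: funext. Qed.

Lemma cfunD F G t : (F + G) t = F t + G t. Proof. by []. Qed.
Lemma cfunN F t : (- F) t = - F t. Proof. by []. Qed.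
Lemma cfunZ k F t : (k *: F) t = k * F t. Proof. by []. Qed.

Lemma cfun_rel F t t1 s t2 : C t t1 s t2 -> F t = F t1 + s * F t2.
Proof. by have /asboolP[+ _] := valP F; exact. Qed.

(** The least admissible constant, so that zeros of [u] cause no division. The infimum is taken in
    [R] and then embedded in [K]. *)
Definition cfun_norm F : K :=
  (inf [set M : R | 0 <= M /\ forall t, `|F t| <= M%:C * `|u t| ])%:C.

Let bounds F := [set M : R | 0 <= M /\ forall t, `|F t| <= M%:C * `|u t| ].

Let has_inf_bounds F : has_inf (bounds F).
Proof.
split; last by exists 0 => M [].
have /asboolP[_ [M FM]] := valP F.
exists (complex.Re `|M|); split; first exact: Re_ge0.
by move=> t; rewrite RRe_norm; exact: ge0_bound.
Qed.

Lemma cfun_norm_ge0 F : 0 <= cfun_norm F.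
Proof.
rewrite ler0c; apply: lb_le_inf; first by case: (has_inf_bounds F).
by move=> M [].
Qed.

(** The infimum is attained: where [u t] is nonzero, every admissible constant is at least
    [|F t| / |u t|]; elsewhere any of them forces [F t = 0]. *)
Lemma le_cfun_norm F t : `|F t| <= cfun_norm F * `|u t|.
Proof.
have [[M [M0 FM]] _] := has_inf_bounds F.
have [ut0 | ut0] := eqVneq `|u t| 0.
  by have := FM t; rewrite ut0 !mulr0.
have ugt0 : 0 < `|u t| by rewrite lt_neqAle eq_sym ut0 normr_ge0.
rewrite -ler_pdivrMr// -[leLHS]RRe_ge0 ?divr_ge0// lecR.
apply: lb_le_inf; first by case: (has_inf_bounds F).
move=> N [N0 FN].
by rewrite -lecR RRe_ge0 ?divr_ge0// ler_pdivrMr.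
Qed.

Lemma cfun_norm_le F (M : K) : 0 <= M ->
  (forall t, `|F t| <= M * `|u t|) -> cfun_norm F <= M.
Proof.
move=> M0 FM; rewrite -(RRe_ge0 M0) lecR; apply: ge_inf.
  by case: (has_inf_bounds F).
by split; [exact: Re_ge0 | rewrite RRe_ge0].
Qed.

Let cfun_normD F G : cfun_norm (F + G) <= cfun_norm F + cfun_norm G.
Proof.
apply: cfun_norm_le => [|t]; first by rewrite addr_ge0 ?cfun_norm_ge0.
by rewrite mulrDl (le_trans (ler_normD _ _))// lerD ?le_cfun_norm.
Qed.

Let cfun_normZ_le k F : cfun_norm (k *: F) <= `|k| * cfun_norm F.
Proof.
apply: cfun_norm_le => [|t]; first by rewrite mulr_ge0 ?cfun_norm_ge0.
by rewrite normrM -mulrA ler_wpM2l ?le_cfun_norm.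
Qed.

Let cfun_normZ k F : cfun_norm (k *: F) = `|k| * cfun_norm F.
Proof.
apply/le_anti; rewrite cfun_normZ_le/=.
have [->|k0] := eqVneq k 0; first by rewrite normr0 mul0r cfun_norm_ge0.
(* The reverse inequality is [cfun_normZ_le] for the scalar [k^-1] and the vector [k *: F]. *)
rewrite -ler_pdivlMl ?normr_gt0// -normfV.
by rewrite -{1}[F](scalerK k0) cfun_normZ_le.
Qed.

Let cfun_norm_eq0 F : cfun_norm F = 0 -> F = 0.
Proof.
move=> F0; apply: cfunP => t; apply/eqP; rewrite -normr_le0.
by rewrite (le_trans (le_cfun_norm _ _))// F0 mul0r.
Qed.

HB.instance Definition _ := Lmodule_isNormed.Build K cfun
  cfun_normD cfun_normZ cfun_norm_eq0.

Lemma cfun_le_norm F t : `|F t| <= `|F| * `|u t|.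
Proof. exact: le_cfun_norm. Qed.

Lemma norm_cfun_le F (M : K) : 0 <= M ->
  (forall t, `|F t| <= M * `|u t|) -> `|F| <= M.
Proof. exact: cfun_norm_le. Qed.

(** Functions outside the space are sent to the default 0, so operators can be defined first and
    their side conditions discharged afterwards through [to_cfunE]. *)
Definition to_cfun (f : T -> K) : cfun := insubd 0 f.

Lemma to_cfunE (f : T -> K) :
  (forall t t1 s t2, C t t1 s t2 -> f t = f t1 + s * f t2) ->
  (exists M : K, forall t, `|f t| <= M * `|u t|) ->
  forall t, to_cfun f t = f t.
Proof.
move=> fC fM t; rewrite /to_cfun.
by rewrite -[LHS]/(\val (insubd 0 f : cfun) t) insubdK//; apply/asboolP.
Qed.

(** The filter converges pointwise; its members of small diameter turn this into convergence in
    norm, the estimates being uniform relative to [|u t|]. *)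
Let cfun_complete (F : set_system cfun) : ProperFilter F -> cauchy F -> cvg F.
Proof.
move=> FF /cauchy_ballP Fc.
have Fd (e : R) : 0 < e ->
    exists2 P, F P & forall f g, P f -> P g -> `|f - g| < e%:C.
  move=> e0; have e20 : 0 < (e / 2)%:C by rewrite ltcR divr_gt0.
  have /cauchyP /(_ _ e20)[f Ff] : cauchy F by apply/cauchy_ballP.
  exists (ball f (e / 2)%:C) => // g h; rewrite -!ball_normE/= => fg fh.
  rewrite -(subrKA f) (le_lt_trans (ler_normD _ _))//.
  by rewrite [e]splitr rmorphD ltrD// distrC.
have lim t : exists l : K, forall e : R, 0 < e -> F [set f | `|l - f t| < e%:C].
  (* Adding 1 keeps the divisor positive where [u] vanishes. *)
  pose c := complex.Re `|u t| + 1.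
  have c0 : 0 < c by rewrite ltr_wpDl// Re_ge0.
  have uc : `|u t| <= c%:C by rewrite -RRe_norm lecR lerDl.
  have FtF : ProperFilter ((fun f : cfun => f t) @ F) by exact: fmap_proper_filter.
  have [e e0|l hl] := complex_cauchy_cvg FtF; last by exists l; exact: hl.
  have [P FP Pe] := Fd (e / c) (divr_gt0 e0 c0).
  have [f Pf] := filter_ex FP; exists (f t).
  rewrite /nbhs/=; apply: filterS FP => g Pg /=.
  rewrite -cfunN -cfunD (le_lt_trans (cfun_le_norm _ _))//.
  rewrite (le_lt_trans (ler_wpM2l _ uc))//.
  have c0' : 0 < c%:C by rewrite ltcR.
  rewrite -[e](divfK (lt0r_neq0 c0)) (rmorphM (real_complex R)) ltr_pM2r//.
  exact: Pe.
have [g hg] := choice lim.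
(* A member [f] of a small set is compared with [g] through a second member [f'], chosen close to
   [g] at the single point [t]. *)
have gP (e : R) P : 0 < e -> F P ->
    (forall f f', P f -> P f' -> `|f - f'| < e%:C) ->
    forall f t, P f -> `|g t - f t| <= e%:C * `|u t|.
  move=> e0 FP Pe f t Pf; apply/ler_addgt0Pr => d d0.
  have d0' : 0 < complex.Re d by move: d0; rewrite ltcE => /andP[].
  have [f' [Pf' /= gf']] := filter_ex (filterI FP (hg t _ d0')).
  rewrite -(subrKA (f' t)) addrC (le_trans (ler_normD _ _))//.
  rewrite lerD//; last by move: gf'; rewrite (RRe_ge0 (ltW d0)) => /ltW.
  rewrite -cfunN -cfunD (le_trans (cfun_le_norm _ _))//.
  by rewrite ler_wpM2r// ltW// Pe.
have gC t t1 s t2 : C t t1 s t2 -> g t = g t1 + s * g t2.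
  move=> Ct; apply/eqP; rewrite -subr_eq0 -normr_le0.
  apply/ler_addgt0Pr => d d0; rewrite add0r.
  (* Three values of [g] are approximated at once with weights 1, 1 and [|s|], hence the tolerance
     [d / (2 + |s|)]. *)
  have [d' d'0 dd'] : exists2 d' : R, 0 < d' & (2 + `|s|) * d'%:C <= d.
    have s0 : 0 < 2 + `|s| by rewrite ltr_pwDl.
    have ds0 : 0 < d / (2 + `|s|) by rewrite divr_gt0.
    exists (complex.Re (d / (2 + `|s|))).
      by move: ds0; rewrite ltcE => /andP[].
    by rewrite (RRe_ge0 (ltW ds0)) mulrCA divff ?mulr1// gt_eqF.
  have [f [[/= h1 h2] h3]] := filter_ex
    (filterI (filterI (hg t _ d'0) (hg t1 _ d'0)) (hg t2 _ d'0)).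
  have -> : g t - (g t1 + s * g t2) =
      (g t - f t) - (g t1 - f t1) - s * (g t2 - f t2).
    by rewrite (cfun_rel f Ct); ring.
  rewrite (le_trans _ dd')// mulrDl.
  rewrite (le_trans (ler_normB _ _))// lerD//.
    rewrite (le_trans (ler_normB _ _))// mulr_natl mulr2n.
    by rewrite lerD// ltW.
  by rewrite normrM ler_wpM2l// ltW.
have gE : to_cfun g =1 g.
  apply: to_cfunE => //.
  have [P FP P1] := Fd 1 ltr01; have [f Pf] := filter_ex FP.
  exists (1 + `|f|) => t; rewrite -(subrK (f t) (g t)) mulrDl.
  rewrite (le_trans (ler_normD _ _))// lerD ?cfun_le_norm//.
  exact: (gP _ _ ltr01 FP P1).
apply/cvg_ex; exists (to_cfun g); apply/cvgrPdist_le => d d0.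
have d0' : 0 < complex.Re d by move: d0; rewrite ltcE => /andP[].
have [P FP Pd] := Fd _ d0'.
apply: filterS (FP) => f Pf.
rewrite -(RRe_ge0 (ltW d0)); apply: norm_cfun_le => [|t].
  by rewrite ler0c ltW.
by rewrite cfunD cfunN gE; exact: (gP _ _ d0' FP Pd).
Qed.

HB.instance Definition _ := Uniform_isComplete.Build cfun cfun_complete.

End ConstrainedFunctions.

(** * Pullback along maps compatible with weights and constraints *)

Section Pullback.
Variable R : realType.
Local Notation K := R[i].
Variables (T T' : Type) (u : T -> K) (u' : T' -> K).
Variables (C : T -> T -> K -> T -> Prop) (C' : T' -> T' -> K -> T' -> Prop).
Implicit Types (h : T' -> T) (F : cfun u C).

Definition admissible h :=
  (forall t t1 s t2, C' t t1 s t2 -> C (h t) (h t1) s (h t2)) /\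
  exists c : K, forall t, `|u (h t)| <= c * `|u' t|.

Definition pull h F : cfun u' C' := to_cfun u' C' (F \o h).

Lemma pullE h F t : admissible h -> pull h F t = F (h t).
Proof.
move=> [hC [c hc]]; apply: to_cfunE => [t0 t1 s t2 Ct|].
  exact/cfun_rel/hC.
exists (`|F| * c) => t' /=; rewrite (le_trans (cfun_le_norm _ _))//.
by rewrite -mulrA ler_wpM2l.
Qed.

Lemma norm_pull_le h F (c : K) : admissible h -> 0 <= c ->
  (forall t, `|u (h t)| <= c * `|u' t|) -> `|pull h F| <= c * `|F|.
Proof.
move=> ah c0 hc; apply: norm_cfun_le => [|t]; first by rewrite mulr_ge0.
rewrite pullE// (le_trans (cfun_le_norm _ _))//.
by rewrite (mulrC c) -mulrA ler_wpM2l.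
Qed.

End Pullback.

(** * Dual spaces as constrained function spaces *)

Section Dual.
Variable R : realType.
Local Notation K := R[i].

Definition lin_rel (V : lmodType K) (t v1 : V) (s : K) (v2 : V) :=
  t = v1 + s *: v2.

Definition dual (V : normedModType K) : completeNormedModType K :=
  cfun (fun v : V => `|v|) (@lin_rel V).

Variable V : normedModType K.
Implicit Types f : dual V.

Lemma dualP f v1 s v2 : f (v1 + s *: v2) = f v1 + s * f v2.
Proof. exact: cfun_rel. Qed.

Lemma dualD f v1 v2 : f (v1 + v2) = f v1 + f v2.
Proof. by rewrite -{1}[v2]scale1r dualP mul1r. Qed.

Lemma dual0 f : f 0 = 0.
Proof. by apply: (addrI (f 0)); rewrite -dualD !addr0. Qed.

Lemma dualZ f k v : f (k *: v) = k * f v.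
Proof. by rewrite -[k *: v]add0r dualP dual0 add0r. Qed.

Lemma dual_le_norm f v : `|f v| <= `|f| * `|v|.
Proof. by rewrite (le_trans (cfun_le_norm f v))// normr_id. Qed.

Lemma to_dualE (g : V -> K) : (forall v1 s v2, g (v1 + s *: v2) = g v1 + s * g v2) ->
  (exists M : K, forall v, `|g v| <= M * `|v|) ->
  forall v, (to_cfun _ _ g : dual V) v = g v.
Proof.
move=> gP [M gM] v; apply: to_cfunE; first by move=> t v1 s v2 ->; exact: gP.
by exists M => w; rewrite normr_id.
Qed.

Lemma admissible_linear (V' : normedModType K) (h : V' -> V) :
  (forall v1 s v2, h (v1 + s *: v2) = h v1 + s *: h v2) ->
  (exists c : K, forall v, `|h v| <= c * `|v|) ->
  admissible (fun v : V => `|v|) (fun v : V' => `|v|) (@lin_rel V) (@lin_rel V') h.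
Proof.
move=> hl [c hc]; split=> [t v1 s v2 ->|]; first exact: hl.
by exists c => v; rewrite !normr_id.
Qed.

End Dual.

(** * Bounded linear functionals given as plain functions *)

Section DualElt.
Variables (R : realType) (X : completeNormedModType R[i]).
Implicit Types f g : X -> R[i].

Lemma dual_elt_lin f v1 s v2 : dual_elt f -> f (v1 + s *: v2) = f v1 + s * f v2.
Proof. by move=> [fD fZ _]; rewrite fD fZ. Qed.

Lemma dual_elt0 f : dual_elt f -> f 0 = 0.
Proof. by move=> [_ fZ _]; rewrite -(scale0r 0) fZ mul0r. Qed.

Lemma dual_eltB f v1 v2 : dual_elt f -> f (v1 - v2) = f v1 - f v2.
Proof. by move=> [fD fZ _]; rewrite fD -scaleN1r fZ mulN1r. Qed.

Lemma dual_elt_bound f : dual_elt f ->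
  exists2 M : R[i], 0 <= M & forall x, `|f x| <= M * `|x|.
Proof. by move=> [_ _ [M fM]]; exists `|M| => // x; exact: ge0_bound. Qed.

Lemma linear_dual_elt f : (forall v1 s v2, f (v1 + s *: v2) = f v1 + s * f v2) ->
  (exists M : R[i], forall x, `|f x| <= M * `|x|) -> dual_elt f.
Proof.
move=> fl fM; have fD x y : f (x + y) = f x + f y.
  by rewrite -{1}[y]scale1r fl mul1r.
have f0 : f 0 = 0 by apply: (addrI (f 0)); rewrite -fD !addr0.
by split=> // k x; rewrite -[k *: x]add0r fl f0 add0r.
Qed.

Lemma dual_eltD f g : dual_elt f -> dual_elt g -> dual_elt (fun x => f x + g x).
Proof.
move=> hf hg; apply: linear_dual_elt => [v1 s v2|].
  by rewrite !dual_elt_lin//; ring.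
have [M _ fM] := dual_elt_bound hf; have [N _ gN] := dual_elt_bound hg.
exists (M + N) => x; rewrite mulrDl (le_trans (ler_normD _ _))//.
by rewrite lerD.
Qed.

Lemma dual_eltN f : dual_elt f -> dual_elt (fun x => - f x).
Proof.
move=> hf; apply: linear_dual_elt => [v1 s v2|].
  by rewrite !dual_elt_lin//; ring.
by have [M _ fM] := dual_elt_bound hf; exists M => x; rewrite normrN.
Qed.

End DualElt.

Lemma dual_elt_comp (R : realType) (X Y : completeNormedModType R[i])
    (f : X -> R[i]) (h : Y -> X) :
  dual_elt f -> (forall v1 s v2, h (v1 + s *: v2) = h v1 + s *: h v2) ->
  (exists M : R[i], forall y, `|h y| <= M * `|y|) -> dual_elt (f \o h).
Proof.
move=> hf hl [N hN]; apply: linear_dual_elt => [v1 s v2 /=|].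
  by rewrite hl dual_elt_lin.
have [M M0 fM] := dual_elt_bound hf; exists (M * N) => y /=.
by rewrite (le_trans (fM _))// -mulrA ler_wpM2l.
Qed.

(** * Nets *)

Section Nets.

Lemma eventually_ex (N : dirset) (P : N -> Prop) : Defs.eventually P -> exists i, P i.
Proof. by move=> [i Pi]; exists i; apply: Pi; exact: dle_refl. Qed.

Lemma eventually_all (N : dirset) (B : eqType) (P : B -> N -> Prop) (F : seq B) :
  (forall b, b \in F -> Defs.eventually (P b)) ->
  Defs.eventually (fun i => forall b, b \in F -> P b i).
Proof.
elim: F => [|a F IH] h; first by have [i0] := dI_inh N; exists i0.
have [i hi] := h a (mem_head _ _).
have [|j hj] := IH; first by move=> b bF; apply: h; rewrite inE bF orbT.
have [k [ik jk]] := dle_dir i j; exists k => l kl b.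
rewrite inE => /orP[/eqP->|bF]; first exact/hi/(dle_trans ik).
exact: (hj l (dle_trans jk kl)).
Qed.

(** A pair [(F, n)] stands for the tolerance [1 / (n + 1)] on the finite set [F]. *)
Definition finite_approx_le (B : eqType) (i j : seq B * nat) :=
  {subset i.1 <= j.1} /\ (i.2 <= j.2)%N.

Program Definition finite_approx_dirset (B : eqType) : dirset :=
  @DirSet (seq B * nat)%type (@finite_approx_le B) _ _ _ (inhabits ([::], 0%N)).
Next Obligation. by move=> B i; split. Qed.
Next Obligation.
move=> B i j k [ij1 ij2] [jk1 jk2].
by split; [move=> b /ij1/jk1 | exact: leq_trans ij2 jk2].
Qed.
Next Obligation.
move=> B i j; exists (i.1 ++ j.1, maxn i.2 j.2); split; split=> /=.
- by move=> b bi; rewrite mem_cat bi.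
- exact: leq_maxl.
- by move=> b bj; rewrite mem_cat bj orbT.
- exact: leq_maxr.
Qed.

Lemma net_of_finite_approx (R : realType) (B : eqType) (Z : Type)
    (P : B -> R[i] -> Z -> Prop) :
  (forall b e e' z, e <= e' -> P b e z -> P b e' z) ->
  (forall (F : seq B) e, 0 < e -> exists z, forall b, b \in F -> P b e z) ->
  exists (N : dirset) (z : N -> Z),
    forall b e, 0 < e -> Defs.eventually (fun i => P b e (z i)).
Proof.
move=> Pmono Pex.
have ex (i : finite_approx_dirset B) :
    exists z, forall b, b \in i.1 -> P b (i.2.+1%:R^-1) z.
  by apply: Pex; rewrite invr_gt0.
have [z hz] := choice ex; exists (finite_approx_dirset B), z => b e e0.
have re0 : 0 < complex.Re e by move: e0; rewrite ltcE => /andP[].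
(* [n + 1] exceeds [1 / e], so from level [n] on the tolerance is at most [e]. *)
pose n := Num.truncn (complex.Re e)^-1.
exists ([:: b], n) => i [bi ni]; apply: (Pmono b (i.2.+1%:R^-1)); last first.
  by apply: hz; apply: bi; rewrite inE.
rewrite -[leRHS](invrK e) lef_pV2 ?posrE ?invr_gt0//.
rewrite -(RRe_ge0 (ltW e0)) -fmorphV -(rmorph_nat (real_complex R)) lecR.
rewrite ltW// (lt_le_trans (truncnS_gt _))//.
by rewrite ler_nat ltnS.
Qed.

End Nets.

(** * Hahn-Banach *)

Section HahnBanach.
Variables (R : realType) (V : lmodType R[i]).
Implicit Types (p q : V -> R) (u v a : V).

(** Only real scalars occur: [V] is treated as a real space. The inequality for positive [r] already
    implies equality, by [sublinearZ]. *)
Definition sublinear p := (forall u v, p (u + v) <= p u + p v) /\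
  (forall (r : R) v, 0 < r -> p (r%:C *: v) <= r * p v).

Lemma sublinear0 p : sublinear p -> p 0 = 0.
Proof.
move=> [pD pZ]; have := pD 0 0; rewrite addr0 => h0.
have := pZ (1 / 2) 0 ltac:(lra); rewrite scaler0; lra.
Qed.

Lemma sublinearN p v : sublinear p -> - p (- v) <= p v.
Proof.
by move=> sp; have [pD _] := sp; have := pD v (- v); rewrite subrr sublinear0//; lra.
Qed.

Lemma sublinearZ p (r : R) v : sublinear p -> 0 <= r -> p (r%:C *: v) = r * p v.
Proof.
move=> sp; have [_ pZ] := sp; rewrite le_eqVlt => /orP[/eqP <-|r0].
  by rewrite scale0r mul0r sublinear0.
apply/le_anti; rewrite pZ//= -ler_pdivlMl//.
have := pZ r^-1 (r%:C *: v); rewrite invr_gt0 => /(_ r0).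
by rewrite scalerA -rmorphM/= mulVf ?gt_eqF// scale1r.
Qed.

(** A sublinear functional below [p] whose value at [- a] is at most [- p a] (take [t = 1]); it
    measures the failure of [p] to be additive in the direction [a]. *)
Definition shift p a v : R :=
  inf [set p (v + t%:C *: a) - t * p a | t in [set t : R | 0 <= t]].

Section Shift.
Variables (p : V -> R) (a : V).
Hypothesis sp : sublinear p.

Let S v := [set p (v + t%:C *: a) - t * p a | t in [set t : R | 0 <= t]].

Let S0 v : S v !=set0.
Proof. by exists (p (v + 0%:C *: a) - 0 * p a), 0 => /=. Qed.

Let Slb v : has_lbound (S v).
Proof.
exists (- p (- v)) => _ [t /= t0 <-].
rewrite -(sublinearZ a sp t0); have [pD _] := sp.
have := pD (v + t%:C *: a) (- v).
by rewrite addrAC subrr add0r; lra.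
Qed.

Lemma shift_le v (t : R) : 0 <= t -> shift p a v <= p (v + t%:C *: a) - t * p a.
Proof. by move=> t0; apply: (ge_inf (Slb v)); exists t. Qed.

Lemma le_shift v (M : R) :
  (forall t : R, 0 <= t -> M <= p (v + t%:C *: a) - t * p a) -> M <= shift p a v.
Proof. by move=> h; apply: (lb_le_inf (S0 v)) => _ [t t0 <-]; exact: h. Qed.

Lemma shift_le_id v : shift p a v <= p v.
Proof. by have := shift_le v (lexx 0); rewrite scale0r addr0 mul0r subr0. Qed.

Lemma sublinear_shift : sublinear (shift p a).
Proof.
have [pD pZ] := sp; split=> [u v|r v r0].
  rewrite -lerBlDr; apply: le_shift => t t0.
  rewrite lerBlDr -lerBlDl; apply: le_shift => s s0.
  have := shift_le (u + v) (addr_ge0 t0 s0).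
  have := pD (u + t%:C *: a) (v + s%:C *: a).
  by rewrite addrACA -scalerDl -rmorphD/=; lra.
rewrite -ler_pdivrMl//; apply: le_shift => t t0.
rewrite ler_pdivrMl//.
have := shift_le (r%:C *: v) (mulr_ge0 (ltW r0) t0).
have := pZ r (v + t%:C *: a) r0.
by rewrite scalerDr scalerA -rmorphM/=; lra.
Qed.

End Shift.

(** Zorn's lemma for the reversed pointwise order. A nonempty chain is bounded by its pointwise
    infimum, which is finite because a sublinear functional below [p] is at least [- p (- v)] at
    [v]. *)
Lemma exists_minimal_sublinear p : sublinear p ->
  exists q, [/\ sublinear q, forall v, q v <= p v &
    forall q', sublinear q' -> (forall v, q' v <= q v) -> q' = q].
Proof.
move=> sp.
pose T := {q : V -> R | sublinear q /\ forall v, q v <= p v}.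
pose r (s t : T) := `[< forall v, sval t v <= sval s v >].
have sval_inj (s t : T) : sval s = sval t -> s = t.
  by case: s t => [s hs] [t ht] /= st; subst t; congr exist; exact: Prop_irrelevance.
have [||||[q [sq qp]] qmin] := @Zorn T r.
- by move=> t; apply/asboolP.
- move=> s t w /asboolP st /asboolP tw; apply/asboolP => v.
  exact: le_trans (tw v) (st v).
- move=> s t /asboolP st /asboolP ts; apply: sval_inj; apply/funext => v.
  by apply/le_anti; rewrite st ts.
- move=> B Btot; have [B0|] := pselect (B !=set0); last first.
    move=> B0; exists (exist _ p (conj sp (fun=> lexx _))) => s Bs.
    by case: B0; exists s.
  pose m v := inf [set sval s v | s in B].
  have mS v : [set sval s v | s in B] !=set0.
    by have [s Bs] := B0; exists (sval s v), s.
  have mlb v : has_lbound [set sval s v | s in B].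
    exists (- p (- v)) => _ [[s [ss sp']] Bs <-] /=.
    have := sublinearN v ss; have := sp' (- v); lra.
  have mle v s : B s -> m v <= sval s v.
    by move=> Bs; apply: (ge_inf (mlb v)); exists s.
  have lem v (M : R) : (forall s, B s -> M <= sval s v) -> M <= m v.
    by move=> h; apply: (lb_le_inf (mS v)) => _ [s Bs <-]; exact: h.
  have sm : sublinear m.
    split=> [u v|k v k0].
      rewrite -lerBlDr; apply: (lem u) => s Bs.
      rewrite lerBlDr -lerBlDl; apply: (lem v) => t Bt.
      have [[sD _] _] := svalP s; have [[tD _] _] := svalP t.
      (* Of the two members the smaller one serves for both summands, so its own subadditivity
         suffices. *)
      have [/asboolP st|/asboolP ts] := Btot s t Bs Bt.
        by have := mle (u + v) _ Bt; have := tD u v; have := st u; lra.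
      by have := mle (u + v) _ Bs; have := sD u v; have := ts v; lra.
    rewrite -ler_pdivrMl//; apply: (lem v) => s Bs; rewrite ler_pdivrMl//.
    have [[_ sZ] _] := svalP s.
    exact: le_trans (mle _ _ Bs) (sZ _ _ k0).
  have mp v : m v <= p v.
    by have [s Bs] := B0; rewrite (le_trans (mle _ _ Bs))//; case: (svalP s).
  by exists (exist _ m (conj sm mp)) => s Bs; apply/asboolP => v /=; exact: mle.
exists q; split=> // q' sq' q'q.
have q'p v : q' v <= p v by exact: le_trans (q'q v) (qp v).
have := qmin (exist _ q' (conj sq' q'p)).
by move=> /(_ (introT (asboolP _) q'q)) /(congr1 sval).
Qed.

(** Minimality makes [q] equal to its shift along [u], and [t = 1] in that shift gives
    [q v + q u <= q (v + u)]. *)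
Lemma minimal_sublinearD q : sublinear q ->
  (forall q', sublinear q' -> (forall v, q' v <= q v) -> q' = q) ->
  forall u v, q (u + v) = q u + q v.
Proof.
move=> sq qmin u v; apply/le_anti; have [-> _] := sq; rewrite /=.
have <- := qmin _ (sublinear_shift u sq) (shift_le_id u sq).
have := shift_le u sq v ler01.
rewrite (qmin _ (sublinear_shift u sq) (shift_le_id u sq)).
by rewrite scale1r mul1r (addrC v); lra.
Qed.

Lemma hahn_banach_sublinear p : sublinear p -> forall v0, exists g : V -> R,
  [/\ forall u v, g (u + v) = g u + g v,
      forall (r : R) v, g (r%:C *: v) = r * g v,
      forall v, g v <= p v & g v0 = p v0].
Proof.
move=> sp v0.
(* Minimizing below the shift along [v0], rather than below [p], forces [g (- v0) <= - p v0] and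
   hence equality at [v0]. *)
have [g [sg gp gmin]] := exists_minimal_sublinear (sublinear_shift v0 sp).
have gD := minimal_sublinearD sg gmin.
have gN v : g (- v) = - g v.
  by have := gD v (- v); rewrite subrr sublinear0//; lra.
have gp' v : g v <= p v := le_trans (gp v) (shift_le_id v0 sp v).
exists g; split=> // [r v|].
  have [r0|r0] := leP 0 r; first exact: sublinearZ.
  have := sublinearZ v sg (_ : 0 <= - r); rewrite oppr_ge0 => /(_ (ltW r0)).
  by rewrite rmorphN/= scaleNr gN; lra.
apply/le_anti; rewrite gp'/=.
have := le_trans (gp (- v0)) (shift_le v0 sp (- v0) ler01).
by rewrite scale1r addNr sublinear0// gN; lra.
Qed.

(* [Re f] determines [f] through [f v = Re f v - i Re f (i v)], which reduces
   the complex case to the real one. *)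
Lemma hahn_banach_seminorm p : (forall u v, p (u + v) <= p u + p v) ->
  (forall k v, p (k *: v) <= complex.Re `|k| * p v) ->
  forall v0, 0 < p v0 -> exists f : V -> R[i],
  [/\ forall u s v, f (u + s *: v) = f u + s * f v,
      forall v, `|f v| <= (2 * p v)%:C & f v0 != 0].
Proof.
move=> pD pZ v0 pv0.
have sp : sublinear p.
  split=> // r v r0; rewrite (le_trans (pZ _ _))//.
  by rewrite norm_real_complex /= gtr0_norm.
have [g [gD gZ gp gv0]] := hahn_banach_sublinear sp v0.
have pN v : p (- v) <= p v.
  by have := pZ (-1) v; rewrite scaleN1r normrN1 mul1r.
have pi v : p ('i%C *: v) <= p v.
  have := pZ 'i%C v.
  by rewrite normc_def/= expr0n add0r expr1n sqrtr1 mul1r.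
have gN v : g (- v) = - g v.
  have := gZ (-1) v; rewrite mulN1r => <-.
  by rewrite rmorphN1 scaleN1r.
have ag v : `|g v| <= p v.
  by rewrite ler_norml gp andbT lerNl -gN (le_trans (gp _)).
exists (fun v => g v +i* - g ('i%C *: v)); split.
- move=> u [a b] v.
  have -> : (a +i* b) *: v = a%:C *: v + b%:C *: ('i%C *: v).
    by rewrite scalerA -scalerDl {1}[a +i* b]complexE/= mulrC.
  have -> : 'i%C *: (u + (a%:C *: v + b%:C *: ('i%C *: v))) =
      'i%C *: u + (a%:C *: ('i%C *: v) + (- b)%:C *: v).
    rewrite !scalerDr !scalerA; congr (_ + (_ + _)); first by rewrite mulrC.
    by rewrite mulrAC -expr2 sqr_i mulN1r rmorphN.
  rewrite !gD !gZ; apply/eqP; rewrite eq_complex/=.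
  by apply/andP; split; apply/eqP; ring.
(* The factor 2 comes from bounding the modulus by the real plus the imaginary part, each at most
   [p v]. *)
- move=> v; rewrite (le_trans (normc_le_ReIm _))//= -rmorphD lecR normrN.
  by have := ag v; have := ag ('i%C *: v); have := pi v; lra.
- by rewrite eq_complex/= gv0 negb_and gt_eqF.
Qed.

End HahnBanach.

(** * Approximate identities *)

Section BanachAlgebra.
Variables (R : realType) (A : completeNormedModType R[i]) (mul : A -> A -> A).
Hypothesis bA : banach_algebra mul.

Lemma mul_linl a b s c : mul (a + s *: b) c = mul a c + s *: mul b c.
Proof. by have [_ mD _ mZ _] := bA; rewrite mD (mZ _ _ _).1. Qed.

Lemma mul_linr a b s c : mul c (a + s *: b) = mul c a + s *: mul c b.
Proof. by have [_ _ mD mZ _] := bA; rewrite mD (mZ _ _ _).2. Qed.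

Lemma banach_mulA a b c : mul (mul a b) c = mul a (mul b c).
Proof. by have [+ _ _ _ _] := bA. Qed.

Lemma norm_mul_le a b : `|mul a b| <= `|a| * `|b|.
Proof. by have [_ _ _ _ +] := bA. Qed.

Lemma mulDl a b c : mul (a + b) c = mul a c + mul b c.
Proof. by have [_ + _ _ _] := bA. Qed.

Lemma mulDr a b c : mul a (b + c) = mul a b + mul a c.
Proof. by have [_ _ + _ _] := bA. Qed.

Lemma mulZl k a b : mul (k *: a) b = k *: mul a b.
Proof. by have [_ _ _ /(_ k a b)[]] := bA. Qed.

Lemma mulZr k a b : mul a (k *: b) = k *: mul a b.
Proof. by have [_ _ _ /(_ k a b)[]] := bA. Qed.

Lemma mul0l b : mul 0 b = 0.
Proof. by rewrite -(scale0r (0 : A)) mulZl !scale0r. Qed.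

Lemma admissible_mulr a :
  admissible (fun v : A => `|v|) (fun v : A => `|v|) (@lin_rel R A) (@lin_rel R A)
    (mul^~ a).
Proof.
apply: admissible_linear => [v1 s v2|]; first exact: mul_linl.
by exists `|a| => v; rewrite mulrC norm_mul_le.
Qed.

End BanachAlgebra.

Section LeftApproximateIdentity.
Variables (R : realType) (A : completeNormedModType R[i]) (mul : A -> A -> A).
Hypothesis bA : banach_algebra mul.
Local Notation K := R[i].

Definition dual_mul (a : A) (f : dual A) : dual A := pull _ _ (mul^~ a) f.

Lemma dual_mulE a f x : dual_mul a f x = f (mul x a).
Proof. exact/pullE/admissible_mulr. Qed.

Lemma dual_mul_bimodule : banach_bimodule mul setT dual_mul (fun _ _ => 0).
Proof.
split.
- move=> a f g _; rewrite addr0; split=> //.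
  by apply: cfunP => x; rewrite cfunD !dual_mulE.
- move=> a b f _ _; rewrite addr0; split=> //.
  by apply: cfunP => x; rewrite cfunD !dual_mulE mulDr// dualD.
- move=> k a f _; rewrite scaler0; split=> //.
    by apply: cfunP => x; rewrite cfunZ !dual_mulE mulZr// dualZ.
  by apply: cfunP => x; rewrite cfunZ !dual_mulE.
- move=> a b f _ _; split=> //.
    by apply: cfunP => x; rewrite !dual_mulE banach_mulA.
  by apply: cfunP => x; rewrite dual_mulE.
- exists 1 => a f _; rewrite normr0 !mul1r; split; last by rewrite mulr_ge0.
  apply: norm_pull_le => // [|x]; first exact: admissible_mulr.
  by rewrite !normr_id mulrC norm_mul_le.
Qed.

(** The zero right action kills the term [dual_lact a (D b)], and what remains of the derivation
    identity is the definition of [dual_mul]. *)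
Lemma eval_derivation :
  cont_derivation mul setT dual_mul (fun _ _ => 0) (fun a (f : dual A) => f a).
Proof.
split.
- move=> a _; split=> //.
  by exists `|a| => f; rewrite mulrC dual_le_norm.
- by move=> a b f _ _; rewrite dualD.
- by move=> k a f _; rewrite dualZ.
- by move=> a b f _ _; rewrite /dual_lact /dual_ract dual_mulE add0r.
- by exists 1 => a f _; rewrite mul1r mulrC dual_le_norm.
Qed.

Lemma left_approx_finite : approx_semi_amenable mul setT ->
  forall (F : seq A) (eps : K), 0 < eps ->
  exists e, forall a, a \in F -> `|mul e a - a| < eps.
Proof.
(* Without repetitions, a sum over [F] meets each coordinate once. *)
move=> asa F0 eps eps0; set F := undup F0.
suff: exists e, forall a, a \in F -> `|mul e a - a| < eps.
  by move=> [e he]; exists e => a aF; apply: he; rewrite mem_undup.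
have uF : uniq F by exact: undup_uniq.
apply: contrapT => nex.
have far e : exists2 a, a \in F & eps <= `|mul e a - a|.
  apply: contrapT => h; apply: nex; exists e => a aF.
  have epsr : eps \is Num.real by exact/ger0_real/ltW.
  rewrite real_ltNge ?normr_real//.
  by apply/negP => le; apply: h; exists a.
(* Functions [A -> A] stand for families indexed by [F]. [pn e v] is the l^1 distance on [F] from
   [v] to [a |-> e a]; [p] is the distance to the subspace of all such families. *)
pose pn (e : A) (v : A -> A) : R := \sum_(a <- F) complex.Re `|v a - mul e a|.
have pnE e v : (pn e v)%:C = \sum_(a <- F) `|v a - mul e a|.
  by rewrite rmorph_sum/=; apply: eq_bigr => a _; rewrite RRe_norm.
have pn_ge0 e v : 0 <= pn e v by apply: sumr_ge0 => a _; exact: Re_ge0.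
pose p v := inf [set pn e v | e in [set: A]].
have S0 v : [set pn e v | e in [set: A]] !=set0 by exists (pn 0 v), 0.
have ple e v : p v <= pn e v.
  by apply: ge_inf; [exists 0 => _ [e' _ <-] | exists e].
have lep v M : (forall e, M <= pn e v) -> M <= p v.
  by move=> h; apply: (lb_le_inf (S0 v)) => _ [e _ <-].
have pD (v w : A -> A) : p (v + w) <= p v + p w.
  rewrite -lerBlDr; apply: (lep _) => e; rewrite lerBlDr -lerBlDl.
  apply: (lep _) => e'; rewrite lerBlDl (le_trans (ple (e + e') _))//.
  rewrite -lecR real_complexD !pnE -big_split/=; apply: ler_sum => a _.
  by rewrite mulDl// opprD addrACA ler_normD.
have pZ k (v : A -> A) : p (k *: v) <= complex.Re `|k| * p v.
  have pZn e : p (k *: v) <= complex.Re `|k| * pn e v.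
    rewrite (le_trans (ple (k *: e) _))// -lecR real_complexM !pnE RRe_norm.
    rewrite mulr_sumr; apply: ler_sum => a _.
    by rewrite mulZl// -scalerBr normrZ.
  have [k0|k0] := eqVneq `|k| 0.
    by have := pZn 0; rewrite k0 !mul0r.
  have rk : 0 < complex.Re `|k|.
    by rewrite -ltcR RRe_norm lt_neqAle eq_sym k0 normr_ge0.
  rewrite -ler_pdivrMl//; apply: (lep _) => e; rewrite ler_pdivrMl//.
(* The assumed failure on [F] keeps the identity family at distance at least [eps] from the
   subspace. *)
have pid : 0 < p id.
  have re0 : 0 < complex.Re eps by move: eps0; rewrite ltcE => /andP[].
  apply: (lt_le_trans re0); apply: (lep _) => e.
  have [a aF ea] := far e.
  rewrite (le_trans (Re_le ea))// /pn (big_rem a)//= distrC lerDl.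
  by apply: sumr_ge0 => b _; exact: Re_ge0.
have [f [fl fp fid]] := hahn_banach_seminorm pD pZ pid.
have fD (v w : A -> A) : f (v + w) = f v + f w by rewrite -{1}[w]scale1r fl mul1r.
have f00 : f 0 = 0 by apply: (addrI (f 0)); rewrite -fD !addr0.
have f0 e v : (forall a, a \in F -> v a = mul e a) -> f v = 0.
  move=> ve; apply/eqP; rewrite -normr_le0 (le_trans (fp v))// (lecR _ 0).
  rewrite pmulr_rle0// (le_trans (ple e v))// /pn big_seq big1// => a aF.
  by rewrite ve// subrr normr0.
(* [fa a] is the component of [f] at [a]: its restriction to families supported there. *)
pose delta (a x : A) : A -> A := fun b => if b == a then x else 0.
pose fa a x := f (delta a x).
have fa_lin a v1 s v2 : fa a (v1 + s *: v2) = fa a v1 + s * fa a v2.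
  rewrite -fl; congr f; apply/funext => b; rewrite /delta !fctE.
  by case: ifP => // _; rewrite scaler0 addr0.
have fa_bound a : exists M : K, forall x, `|fa a x| <= M * `|x|.
  exists (2 * (size F)%:R) => x; rewrite (le_trans (fp _))//.
  rewrite rmorphM/= rmorph_nat -mulrA ler_wpM2l//.
  apply: (@le_trans _ _ (pn 0 (delta a x))%:C); first by rewrite lecR.
  have -> : (size F)%:R * `|x| = \sum_(b <- F) `|x|.
    by rewrite big_const_seq count_predT iter_addr_0 mulr_natl.
  rewrite pnE; apply: ler_sum => b _.
  by rewrite mul0l// subr0 /delta; case: ifP => // _; rewrite normr0.
pose fA a : dual A := to_cfun _ _ (fa a).
have fAE a x : fA a x = fa a x by exact: to_dualE.
have fE v : f v = \sum_(a <- F) fa a (v a).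
  rewrite -(big_morph f fD f00) -[v in LHS](subrK (\sum_(a <- F) delta a (v a))).
  rewrite fD (f0 0) ?add0r// => b bF; rewrite mul0l// !fctE fct_sumE.
  rewrite (bigD1_seq b)//= /delta eqxx big1 ?addr0 ?subrr// => a.
  by rewrite eq_sym => /negbTE ->.
(* At [x] this sum is the value of [f] on the family [a |-> x a], which lies in the subspace that
   [f] kills. *)
have sum0 : \sum_(a <- F) dual_mul a (fA a) = 0.
  apply: cfunP => x.
  have -> : (\sum_(a <- F) dual_mul a (fA a)) x = \sum_(a <- F) fa a (mul x a).
    rewrite (big_morph (fun g : dual A => g x) (id1 := 0) (op1 := +%R))//.
    by apply: eq_bigr => a _; rewrite dual_mulE fAE.
  by rewrite -(fE (mul x)) (f0 x).
have [N [xi [eta [xe]]]] := asa _ _ _ dual_mul_bimodule _ eval_derivation.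
pose c := \sum_(a <- F) `|fA a|.
have c1 : 0 < c + 1 by rewrite ltr_wpDl// sumr_ge0.
(* Chosen so that [d * c < |f id|]; the added 1 covers [c = 0]. *)
pose d := `|f id| / (c + 1) / 2.
have d0 : 0 < d by rewrite !divr_gt0// normr_gt0.
move=> hlim.
have [i0 hi] := eventually_ex (eventually_all (fun a (_ : a \in F) => hlim a I d d0)).
have [xi0 eta0] := xe i0.
have etas : \sum_(a <- F) eta i0 (dual_mul a (fA a)) = 0.
  have etaD : {morph eta i0 : g h / g + h} by case: eta0.
  by rewrite -(big_morph (eta i0) etaD (dual_elt0 eta0)) sum0 dual_elt0.
have : `|f id| <= d * c.
  (* The [eta] terms add up to 0, so inserting them is free; each summand then has modulus at most
     [d * |fA a|], as the [xi] terms vanish with the right action. *)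
  have -> : f id = \sum_(a <- F) (fa a a + eta i0 (dual_mul a (fA a))).
    by rewrite big_split/= etas addr0 fE.
  rewrite (le_trans (ler_norm_sum _ _ _))// mulr_sumr big_seq [leRHS]big_seq.
  apply: ler_sum => a aF; have := hi a aF (fA a).
  by rewrite /dual_lact /dual_ract dual_elt0// sub0r opprK fAE.
have dc0 : 0 <= d * c by rewrite mulr_ge0 ?sumr_ge0// ltW.
apply/negP; rewrite -real_ltNge ?normr_real ?ger0_real//.
rewrite (@le_lt_trans _ _ (d * (c + 1)))//; first by rewrite ler_pM2l// lerDl.
rewrite /d mulrAC divfK ?gt_eqF//.
by rewrite ltr_pdivrMr// mulr_natr mulr2n ltrDl normr_gt0.
Qed.

Lemma has_left_approx_identity_of_asa :
  approx_semi_amenable mul setT -> has_left_approx_identity mul setT.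
Proof.
move=> asa.
have [|F e e0|N [e he]] :=
  @net_of_finite_approx R A A (fun a eps e => `|mul e a - a| < eps).
- by move=> a e e' z ee' /lt_le_trans; exact.
- exact: left_approx_finite.
- by exists N, e; split=> // a _ eps; exact: he.
Qed.

End LeftApproximateIdentity.

(** * Passage to the opposite algebra *)

Section Opposite.
Variables (R : realType) (A : completeNormedModType R[i]) (mul : A -> A -> A).

Lemma opposite_banach_algebra :
  banach_algebra mul -> banach_algebra (fun a b => mul b a).
Proof.
move=> [mA mDl mDr mZ mn]; split=> //.
- by move=> k a b; split; case: (mZ k b a).
- by move=> a b; rewrite mulrC.
Qed.

Lemma opposite_approx_semi_amenable (S : set A) :
  approx_semi_amenable mul S -> approx_semi_amenable (fun a b => mul b a) S.
Proof.
move=> asa X lact ract [h1 h2 h3 h4 [M h5]] D [d1 d2 d3 d4 d5].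
have bm : banach_bimodule mul S (fun a x => ract x a) (fun x a => lact a x).
  split.
  - by move=> a x y Sa; have [] := h1 a x y Sa.
  - by move=> a b x Sa Sb; have [] := h2 a b x Sa Sb.
  - by move=> k a x Sa; have [] := h3 k a x Sa.
  - move=> a b x Sa Sb; have [e1 e2 _] := h4 b a x Sb Sa.
    by have [_ _ <-] := h4 b a x Sb Sa.
  - by exists M => a x Sa; have [] := h5 a x Sa.
have [|N [xi [eta [xe hl]]]] := asa _ _ _ bm D.
  split=> // a b x Sa Sb; rewrite (d4 b a x Sb Sa).
  by rewrite /dual_lact /dual_ract addrC.
(* Exchanging the two actions exchanges [xi] and [eta], with a change of sign. *)
exists N, (fun i x => - eta i x), (fun i x => - xi i x); split.
  by move=> i; have [? ?] := xe i; split; exact: dual_eltN.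
move=> b Sb eps eps0; have [i0 hi] := hl b Sb eps eps0.
exists i0 => i /hi h x; have := h x.
by rewrite /dual_lact /dual_ract opprK [- eta _ _ + _]addrC.
Qed.

End Opposite.

Lemma has_right_approx_identity_of_asa (R : realType)
    (A : completeNormedModType R[i]) (mul : A -> A -> A) : banach_algebra mul ->
  approx_semi_amenable mul setT -> has_right_approx_identity mul setT.
Proof.
move=> bA asa.
exact: (has_left_approx_identity_of_asa (opposite_banach_algebra bA)
  (opposite_approx_semi_amenable asa)).
Qed.

(** * Ideals *)

Section Bimodule.
Variables (R : realType) (A : completeNormedModType R[i]) (mul : A -> A -> A).
Variables (J : set A) (X : completeNormedModType R[i]).
Variables (lact : A -> X -> X) (ract : X -> A -> X).
Hypothesis bX : banach_bimodule mul J lact ract.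

Lemma lact_linr a x s y : J a -> lact a (x + s *: y) = lact a x + s *: lact a y.
Proof.
have [h1 _ h3 _ _] := bX => Ja.
by rewrite (h1 _ _ _ Ja).1; have [_ -> _ _] := h3 s a y Ja.
Qed.

Lemma lactDl a b x : J a -> J b -> lact (a + b) x = lact a x + lact b x.
Proof. by have [_ + _ _ _] := bX => h Ja Jb; case: (h a b x Ja Jb). Qed.

Lemma lactZl s a x : J a -> lact (s *: a) x = s *: lact a x.
Proof. by have [_ _ + _ _] := bX => h Ja; case: (h s a x Ja). Qed.

Lemma lactM a b x : J a -> J b -> lact (mul a b) x = lact a (lact b x).
Proof. by have [_ _ _ + _] := bX => h Ja Jb; case: (h a b x Ja Jb). Qed.

Lemma lact_ract a b x : J a -> J b -> ract (lact a x) b = lact a (ract x b).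
Proof. by have [_ _ _ + _] := bX => h Ja Jb; case: (h a b x Ja Jb). Qed.

Lemma bimodule_bound : exists2 M : R[i], 0 <= M & forall a x, J a ->
  `|lact a x| <= M * (`|a| * `|x|) /\ `|ract x a| <= M * (`|a| * `|x|).
Proof.
have [_ _ _ _ [M hM]] := bX; exists `|M| => // a x Ja.
have [] := hM a x Ja; rewrite -!mulrA => h1 h2.
have ax0 : 0 <= `|a| * `|x| by rewrite mulr_ge0.
by split; rewrite -[`|_ : X|]normr_id; apply: ge0_bound => //; rewrite normr_id.
Qed.

End Bimodule.

(** * Balanced trilinear forms on [J * X * J] and the action of [A] *)

Section IdealTensor.
Variables (R : realType) (A : completeNormedModType R[i]) (mul : A -> A -> A).
Hypothesis bA : banach_algebra mul.
Variable J : set A.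
Hypothesis idJ : closed_ideal mul J.
Variables (X : completeNormedModType R[i]).
Variables (lact : A -> X -> X) (ract : X -> A -> X).
Local Notation K := R[i].
Local Notation sJ := {a : A | J a}.

Lemma ideal_lin a s b : J a -> J b -> J (a + s *: b).
Proof. by have [_ _ hD hZ _] := idJ => Ja Jb; apply: hD => //; exact: hZ. Qed.

Lemma ideal_mull a j : J j -> J (mul a j).
Proof. by have [_ _ _ _ h] := idJ => /(h a)[]. Qed.

Lemma ideal_mulr a j : J j -> J (mul j a).
Proof. by have [_ _ _ _ h] := idJ => /(h a)[]. Qed.

Definition tri_weight (t : sJ * X * sJ) : K :=
  `|sval t.1.1| * (`|t.1.2| * `|sval t.2|).

(** Linearity in [j] and [k] is expressed through the underlying elements of [A], since [sJ] carries
    no vector space structure. In the balancing relations the scalar is 0, so the last triple is a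
    dummy. *)
Inductive tri_rel : sJ * X * sJ -> sJ * X * sJ -> K -> sJ * X * sJ -> Prop :=
| tri_linl (j j1 : sJ) s (j2 : sJ) x k : sval j = sval j1 + s *: sval j2 ->
    tri_rel (j, x, k) (j1, x, k) s (j2, x, k)
| tri_linm j x s y k : tri_rel (j, x + s *: y, k) (j, x, k) s (j, y, k)
| tri_linr j x (k k1 : sJ) s (k2 : sJ) : sval k = sval k1 + s *: sval k2 ->
    tri_rel (j, x, k) (j, x, k1) s (j, x, k2)
| tri_ball (j j1 j2 : sJ) x k : sval j = mul (sval j1) (sval j2) ->
    tri_rel (j, x, k) (j1, lact (sval j2) x, k) 0 (j, x, k)
| tri_balr j x (k k1 k2 : sJ) : sval k = mul (sval k1) (sval k2) ->
    tri_rel (j, x, k) (j, ract x (sval k1), k2) 0 (j, x, k).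

Definition tri : completeNormedModType K := cfun tri_weight tri_rel.

Implicit Types (phi : tri) (j k : sJ) (x : X) (y : dual tri).

Lemma tri_weight_ge0 t : 0 <= tri_weight t.
Proof. by rewrite !mulr_ge0. Qed.

Lemma tri_le_norm phi j x k :
  `|phi (j, x, k)| <= `|phi| * (`|sval j| * (`|x| * `|sval k|)).
Proof.
by rewrite (le_trans (cfun_le_norm _ _))// [`|tri_weight _|]ger0_norm ?tri_weight_ge0.
Qed.

Definition smull a j : sJ := exist _ (mul a (sval j)) (ideal_mull a (svalP j)).
Definition smulr j a : sJ := exist _ (mul (sval j) a) (ideal_mulr a (svalP j)).

Definition tri_mull a (t : sJ * X * sJ) := (smull a t.1.1, t.1.2, t.2).
Definition tri_mulr a (t : sJ * X * sJ) := (t.1.1, t.1.2, smulr t.2 a).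

Lemma tri_mull_weight a t : `|tri_weight (tri_mull a t)| <= `|a| * `|tri_weight t|.
Proof.
rewrite !ger0_norm ?tri_weight_ge0// /tri_weight/= mulrA.
by rewrite ler_wpM2r ?norm_mul_le// mulr_ge0.
Qed.

Lemma tri_mulr_weight a t : `|tri_weight (tri_mulr a t)| <= `|a| * `|tri_weight t|.
Proof.
rewrite !ger0_norm ?tri_weight_ge0// /tri_weight/=.
rewrite [leRHS]mulrCA ler_wpM2l// [leRHS]mulrCA ler_wpM2l// mulrC.
exact: norm_mul_le.
Qed.

Lemma admissible_tri_mull a :
  admissible tri_weight tri_weight tri_rel tri_rel (tri_mull a).
Proof.
split; last by exists `|a| => t; exact: tri_mull_weight.
move=> t t1 s t2 []; rewrite /tri_mull /=.
- by move=> j j1 {}s j2 x k jE; apply: tri_linl; rewrite /= jE mul_linr.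
- by move=> j x {}s y k; exact: tri_linm.
- by move=> j x k k1 {}s k2 kE; exact: tri_linr.
- by move=> j j1 j2 x k jE; apply: tri_ball; rewrite /= jE banach_mulA.
- by move=> j x k k1 k2 kE; exact: tri_balr.
Qed.

Lemma admissible_tri_mulr a :
  admissible tri_weight tri_weight tri_rel tri_rel (tri_mulr a).
Proof.
split; last by exists `|a| => t; exact: tri_mulr_weight.
move=> t t1 s t2 []; rewrite /tri_mulr /=.
- by move=> j j1 {}s j2 x k jE; exact: tri_linl.
- by move=> j x {}s y k; exact: tri_linm.
- by move=> j x k k1 {}s k2 kE; apply: tri_linr; rewrite /= kE mul_linl.
- by move=> j j1 j2 x k jE; exact: tri_ball.
- by move=> j x k k1 k2 kE; apply: tri_balr; rewrite /= kE banach_mulA.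
Qed.

(** Duality exchanges the sides: left multiplication on the first copy of [J] gives the right action
    on forms. *)
Definition tri_ract phi a : tri := pull _ _ (tri_mull a) phi.
Definition tri_lact a phi : tri := pull _ _ (tri_mulr a) phi.

Lemma tri_ractE phi a j x k : tri_ract phi a (j, x, k) = phi (smull a j, x, k).
Proof. by rewrite /tri_ract pullE//; exact: admissible_tri_mull. Qed.

Lemma tri_lactE phi a j x k : tri_lact a phi (j, x, k) = phi (j, x, smulr k a).
Proof. by rewrite /tri_lact pullE//; exact: admissible_tri_mulr. Qed.

Lemma norm_tri_ract phi a : `|tri_ract phi a| <= `|a| * `|phi|.
Proof.
by apply: norm_pull_le => //; [exact: admissible_tri_mull | exact: tri_mull_weight].
Qed.

Lemma norm_tri_lact phi a : `|tri_lact a phi| <= `|a| * `|phi|.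
Proof.
by apply: norm_pull_le => //; [exact: admissible_tri_mulr | exact: tri_mulr_weight].
Qed.

Lemma tri_ract_linl phi s psi a :
  tri_ract (phi + s *: psi) a = tri_ract phi a + s *: tri_ract psi a.
Proof.
by apply: cfunP => -[[j x] k]; rewrite cfunD cfunZ !tri_ractE cfunD cfunZ.
Qed.

Lemma tri_lact_linr phi s psi a :
  tri_lact a (phi + s *: psi) = tri_lact a phi + s *: tri_lact a psi.
Proof.
by apply: cfunP => -[[j x] k]; rewrite cfunD cfunZ !tri_lactE cfunD cfunZ.
Qed.

Lemma tri_ract_linr phi a s b :
  tri_ract phi (a + s *: b) = tri_ract phi a + s *: tri_ract phi b.
Proof.
apply: cfunP => -[[j x] k]; rewrite cfunD cfunZ !tri_ractE.
by apply/cfun_rel/tri_linl; rewrite /= mul_linl.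
Qed.

Lemma tri_lact_linl phi a s b :
  tri_lact (a + s *: b) phi = tri_lact a phi + s *: tri_lact b phi.
Proof.
apply: cfunP => -[[j x] k]; rewrite cfunD cfunZ !tri_lactE.
by apply/cfun_rel/tri_linr; rewrite /= mul_linr.
Qed.

Lemma sval_inj j k : sval j = sval k -> j = k.
Proof.
by case: j k => [j Jj] [k Jk] /= jk; subst k; congr exist; exact: Prop_irrelevance.
Qed.

Lemma tri_ractM phi a b : tri_ract phi (mul a b) = tri_ract (tri_ract phi a) b.
Proof.
apply: cfunP => -[[j x] k]; rewrite !tri_ractE; congr (phi (_, _, _)).
by apply: sval_inj; rewrite /= banach_mulA.
Qed.

Lemma tri_lactM phi a b : tri_lact (mul a b) phi = tri_lact a (tri_lact b phi).
Proof.
apply: cfunP => -[[j x] k]; rewrite !tri_lactE; congr (phi (_, _, _)).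
by apply: sval_inj; rewrite /= banach_mulA.
Qed.

Lemma tri_lact_ract phi a b :
  tri_ract (tri_lact a phi) b = tri_lact a (tri_ract phi b).
Proof. by apply: cfunP => -[[j x] k]; rewrite !(tri_ractE, tri_lactE). Qed.

Definition ytri_lact a y : dual tri := pull _ _ (fun phi => tri_ract phi a) y.
Definition ytri_ract y a : dual tri := pull _ _ (fun phi => tri_lact a phi) y.

Let adm_ract a : admissible (fun v : tri => `|v|) (fun v : tri => `|v|)
  (@lin_rel R tri) (@lin_rel R tri) (fun phi => tri_ract phi a).
Proof.
apply: admissible_linear => [v1 s v2|]; first exact: tri_ract_linl.
by exists `|a| => phi; exact: norm_tri_ract.
Qed.

Let adm_lact a : admissible (fun v : tri => `|v|) (fun v : tri => `|v|)
  (@lin_rel R tri) (@lin_rel R tri) (fun phi => tri_lact a phi).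
Proof.
apply: admissible_linear => [v1 s v2|]; first exact: tri_lact_linr.
by exists `|a| => phi; exact: norm_tri_lact.
Qed.

Lemma ytri_lactE a y phi : ytri_lact a y phi = y (tri_ract phi a).
Proof. exact/pullE/adm_ract. Qed.

Lemma ytri_ractE a y phi : ytri_ract y a phi = y (tri_lact a phi).
Proof. exact/pullE/adm_lact. Qed.

Lemma ytri_bimodule : banach_bimodule mul setT ytri_lact ytri_ract.
Proof.
split.
- move=> a y z _; split; apply: cfunP => phi.
    by rewrite cfunD !ytri_lactE.
  by rewrite cfunD !ytri_ractE.
- move=> a b y _ _; split; apply: cfunP => phi.
    by rewrite cfunD !ytri_lactE -{1}[b]scale1r tri_ract_linr scale1r dualD.
  by rewrite cfunD !ytri_ractE -{1}[b]scale1r tri_lact_linl scale1r dualD.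
- have ract0 phi : tri_ract phi 0 = 0.
    by have := tri_ract_linr phi 0 (-1) 0; rewrite scaler0 addr0 scaleN1r subrr.
  have lact0 phi : tri_lact 0 phi = 0.
    by have := tri_lact_linl phi 0 (-1) 0; rewrite scaler0 addr0 scaleN1r subrr.
  move=> s a y _; split; apply: cfunP => phi; rewrite cfunZ.
  + by rewrite !ytri_lactE -[s *: a]add0r tri_ract_linr ract0 add0r dualZ.
  + by rewrite !ytri_lactE.
  + by rewrite !ytri_ractE -[s *: a]add0r tri_lact_linl lact0 add0r dualZ.
  + by rewrite !ytri_ractE.
- move=> a b y _ _; split; apply: cfunP => phi.
  + by rewrite !ytri_lactE tri_ractM.
  + by rewrite !ytri_ractE tri_lactM.
  + by rewrite !(ytri_ractE, ytri_lactE) tri_lact_ract.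
- exists 1 => a y _; rewrite mul1r; split.
  + by apply: norm_pull_le => // phi; rewrite !normr_id norm_tri_ract.
  + by apply: norm_pull_le => // phi; rewrite !normr_id norm_tri_lact.
Qed.

(** The elementary tensor [j (x) x (x) k], seen as a functional on balanced forms. *)
Definition ev j x k : dual tri := to_cfun _ _ (fun phi : tri => phi (j, x, k)).

Lemma evE j x k phi : ev j x k phi = phi (j, x, k).
Proof.
apply: to_dualE => //.
exists (tri_weight (j, x, k)) => {}phi.
by rewrite mulrC tri_le_norm.
Qed.

Lemma norm_ev j x k : `|ev j x k| <= `|sval j| * (`|x| * `|sval k|).
Proof.
apply: norm_cfun_le => [|phi]; first by rewrite !mulr_ge0.
by rewrite evE normr_id mulrC tri_le_norm.
Qed.

Lemma ev_linm j x s z k : ev j (x + s *: z) k = ev j x k + s *: ev j z k.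
Proof.
by apply: cfunP => phi; rewrite cfunD cfunZ !evE; exact/cfun_rel/tri_linm.
Qed.

(** Balancing moves [b] from [x] to the right of [j], whereas the module action puts it on the left
    of [j]. The difference is the elementary tensor with first entry [j b - b j], small when [j]
    nearly commutes with [b]. *)
Lemma ev_lact j b x k : J b -> `|ev j (lact b x) k - ytri_lact b (ev j x k)| <=
  `|mul (sval j) b - mul b (sval j)| * (`|x| * `|sval k|).
Proof.
move=> Jb; have Jd : J (mul (sval j) b - mul b (sval j)).
  by rewrite -scaleN1r; apply: ideal_lin; [exact: ideal_mull | exact: ideal_mulr].
have -> : ev j (lact b x) k - ytri_lact b (ev j x k) = ev (exist _ _ Jd) x k.
  apply: cfunP => phi; rewrite cfunD cfunN ytri_lactE !evE tri_ractE.
  have -> : phi (j, lact b x, k) = phi (smulr j b, x, k).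
    have := cfun_rel phi (@tri_ball (smulr j b) j (exist _ b Jb) x k erefl).
    by rewrite mul0r addr0.
  have := cfun_rel phi (@tri_linl (exist _ _ Jd) (smulr j b) (-1) (smull b j) x k _).
  by rewrite /= scaleN1r mulN1r => ->.
exact: norm_ev.
Qed.

Lemma ev_ract j b x k : J b -> `|ev j (ract x b) k - ytri_ract (ev j x k) b| <=
  `|sval j| * (`|x| * `|mul b (sval k) - mul (sval k) b|).
Proof.
move=> Jb; have Jd : J (mul b (sval k) - mul (sval k) b).
  by rewrite -scaleN1r; apply: ideal_lin; [exact: ideal_mulr | exact: ideal_mull].
have -> : ev j (ract x b) k - ytri_ract (ev j x k) b = ev j x (exist _ _ Jd).
  apply: cfunP => phi; rewrite cfunD cfunN ytri_ractE !evE tri_lactE.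
  have -> : phi (j, ract x b, k) = phi (j, x, smull b k).
    have := cfun_rel phi (@tri_balr j x (smull b k) (exist _ b Jb) k erefl).
    by rewrite mul0r addr0.
  have := cfun_rel phi (@tri_linr j x (exist _ _ Jd) (smull b k) (-1) (smulr k b) _).
  by rewrite /= scaleN1r mulN1r => ->.
exact: norm_ev.
Qed.

End IdealTensor.

(** * The extended derivation from [A] into the balanced forms *)

Section IdealDerivation.
Variables (R : realType) (A : completeNormedModType R[i]) (mul : A -> A -> A).
Hypothesis bA : banach_algebra mul.
Variable J : set A.
Hypothesis idJ : closed_ideal mul J.
Variables (X : completeNormedModType R[i]).
Variables (lact : A -> X -> X) (ract : X -> A -> X).
Hypothesis bX : banach_bimodule mul J lact ract.
Variable D : A -> X -> R[i].
Hypothesis derD : cont_derivation mul J lact ract D.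
Local Notation K := R[i].
Local Notation sJ := {a : A | J a}.
Local Notation tri := (tri mul J lact ract).

Lemma der_lin a s b x : J a -> J b -> D (a + s *: b) x = D a x + s * D b x.
Proof.
have [_ dD dZ _ _] := derD => Ja Jb; rewrite dD ?dZ//.
by have [_ _ _ hZ _] := idJ; exact: hZ.
Qed.

Lemma der_dual_elt a : J a -> dual_elt (D a).
Proof. by have [+ _ _ _ _] := derD; exact. Qed.

Lemma derM a b x : J a -> J b -> D (mul a b) x = D b (ract x a) + D a (lact b x).
Proof. by have [_ _ _ + _] := derD => h Ja Jb; rewrite h. Qed.

Lemma der_bound : exists2 M : K, 0 <= M &
  forall a x, J a -> `|D a x| <= M * (`|a| * `|x|).
Proof.
have [_ _ _ _ [M hM]] := derD; exists `|M| => // a x Ja.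
by apply: ge0_bound; rewrite ?mulr_ge0// mulrA hM.
Qed.

(* The value at [j (x) x (x) k] of the unique extension of [D] to [A], obtained
   by solving [D (k a) = k . D a + D k . a] for [D a]. *)
Definition der_ext a : tri := to_cfun _ _ (fun t : sJ * X * sJ =>
  D (mul (sval t.2) a) (lact (sval t.1.1) t.1.2)
  - D (sval t.2) (lact (mul a (sval t.1.1)) t.1.2)).

Let ext_rel a (t t1 : sJ * X * sJ) s t2 : tri_rel mul lact ract t t1 s t2 ->
  let f (t : sJ * X * sJ) := D (mul (sval t.2) a) (lact (sval t.1.1) t.1.2)
    - D (sval t.2) (lact (mul a (sval t.1.1)) t.1.2) in
  f t = f t1 + s * f t2.
Proof.
have dl b x c z : J b -> D b (x + c *: z) = D b x + c * D b z.
  by move=> Jb; exact/dual_elt_lin/der_dual_elt.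
case=> /= {t t1 s t2}.
- move=> [j Jj] [j1 Jj1] s [j2 Jj2] x [k Jk] /= ->.
  have [_ _ _ hZ _] := idJ; have Jka := ideal_mulr idJ a Jk.
  have Ja1 := ideal_mull idJ a Jj1; have Ja2 := ideal_mull idJ a Jj2.
  rewrite mul_linr// !(lactDl bX)//; try exact: hZ.
  by rewrite !(lactZl bX)// !dl//; ring.
- move=> [j Jj] x s z [k Jk] /=.
  have Jka := ideal_mulr idJ a Jk; have Jaj := ideal_mull idJ a Jj.
  by rewrite !(lact_linr bX)// !dl//; ring.
- move=> [j Jj] x [k Jk] [k1 Jk1] s [k2 Jk2] /= ->.
  by rewrite mul_linl// !der_lin//; [ring|exact: (ideal_mulr idJ)..].
- move=> [j Jj] [j1 Jj1] [j2 Jj2] x [k Jk] /= ->.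
  have Jaj := ideal_mull idJ a Jj1.
  rewrite mul0r addr0 -(banach_mulA bA a).
  by rewrite (lactM bX _ Jj1 Jj2) (lactM bX _ Jaj Jj2).
- move=> [j Jj] x [k Jk] [k1 Jk1] [k2 Jk2] /= ->.
  have Jaj : J (mul a j) by exact: (ideal_mull idJ).
  have Jka : J (mul k2 a) by exact: (ideal_mulr idJ).
  (* Right balancing is where the derivation identity enters: expanding [D (k1 (k2 a))] and
     [D (k1 k2)] produces the same term in [D k1], which cancels. *)
  rewrite mul0r addr0 banach_mulA// (derM _ Jk1 Jka) (derM _ Jk1 Jk2).
  rewrite !(lact_ract bX)//.
  have -> : lact (mul k2 a) (lact j x) = lact k2 (lact (mul a j) x).
    by rewrite -!(lactM bX)// banach_mulA.
  ring.
Qed.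

Let ext_bound : exists2 M : K, 0 <= M & forall a (t : sJ * X * sJ),
  `|D (mul (sval t.2) a) (lact (sval t.1.1) t.1.2)
    - D (sval t.2) (lact (mul a (sval t.1.1)) t.1.2)|
  <= M * `|a| * tri_weight t.
Proof.
have [M M0 DM] := der_bound; have [L L0 XL] := bimodule_bound bX.
exists (M * L *+ 2) => [|a [[[j Jj] x] [k Jk]]]; first by rewrite mulrn_wge0 ?mulr_ge0.
rewrite /tri_weight/= mulr2n !mulrDl (le_trans (ler_normB _ _))// lerD//.
- rewrite (le_trans (DM _ _ _))//; first exact: (ideal_mulr idJ).
  rewrite -!mulrA ler_wpM2l//.
  have -> : L * (`|a| * (`|j| * (`|x| * `|k|))) =
    (`|k| * `|a|) * (L * (`|j| * `|x|)) by ring.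
  by rewrite ler_pM// ?norm_mul_le//; case: (XL j x Jj).
- rewrite (le_trans (DM _ _ _))// -!mulrA ler_wpM2l//.
  have -> : L * (`|a| * (`|j| * (`|x| * `|k|))) =
    `|k| * (L * (`|a| * `|j| * `|x|)) by ring.
  rewrite ler_wpM2l//.
  have [h _] := XL (mul a j) x (ideal_mull idJ a Jj).
  by rewrite (le_trans h)// ler_wpM2l// ler_wpM2r// norm_mul_le.
Qed.

Lemma der_extE a (j : sJ) x (k : sJ) : der_ext a (j, x, k) =
  D (mul (sval k) a) (lact (sval j) x) - D (sval k) (lact (mul a (sval j)) x).
Proof.
rewrite /der_ext to_cfunE//; first exact: ext_rel.
have [M M0 hM] := ext_bound; exists (M * `|a|) => t.
by rewrite [`|tri_weight _|]ger0_norm ?tri_weight_ge0.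
Qed.

Lemma norm_der_ext : exists M : K, forall a, `|der_ext a| <= M * `|a|.
Proof.
have [M M0 hM] := ext_bound; exists M => a.
apply: norm_cfun_le => [|[[j x] k]]; first by rewrite mulr_ge0.
by rewrite der_extE [`|tri_weight _|]ger0_norm ?tri_weight_ge0//; exact: hM.
Qed.

Lemma der_ext_lin a s b : der_ext (a + s *: b) = der_ext a + s *: der_ext b.
Proof.
apply: cfunP => -[[[j Jj] x] [k Jk]]; rewrite cfunD cfunZ !der_extE/=.
have [_ _ _ hZ _] := idJ.
rewrite mul_linl// mul_linr// der_lin; [|exact: (ideal_mulr idJ)..].
rewrite (lactDl bX) ?(lactZl bX);
  try by [exact: (ideal_mull idJ)|apply/hZ/(ideal_mull idJ)].
rewrite dual_elt_lin; last exact: der_dual_elt.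
ring.
Qed.

(** The identity telescopes: [D (k a) (b j x)] appears in the two summands with opposite signs. *)
Lemma der_extM a b : der_ext (mul a b) =
  tri_lact idJ a (der_ext b) + tri_ract idJ (der_ext a) b.
Proof.
apply: cfunP => -[[j x] k]; rewrite cfunD (tri_lactE bA) (tri_ractE bA) !der_extE/=.
by rewrite !banach_mulA//; ring.
Qed.

(** Approximate semi-amenability concerns dual modules, so [der_ext] is composed with the canonical
    embedding of [tri] into its bidual. *)
Lemma der_ext_derivation : cont_derivation mul setT
  (ytri_lact (lact := lact) (ract := ract) idJ)
  (ytri_ract (lact := lact) (ract := ract) idJ)
  (fun a (y : dual tri) => y (der_ext a)).
Proof.
split.
- move=> a _; split=> //.
  by exists `|der_ext a| => y; rewrite mulrC dual_le_norm.
- by move=> a b y _ _; rewrite -{1}[b]scale1r der_ext_lin scale1r dualD.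
- have ext0 : der_ext 0 = 0.
    by have := der_ext_lin 0 (-1) 0; rewrite scaler0 addr0 scaleN1r subrr.
  by move=> s a y _; rewrite -[s *: a]add0r der_ext_lin ext0 add0r dualZ.
- move=> a b y _ _.
  by rewrite /dual_lact /dual_ract (ytri_ractE bA) (ytri_lactE bA) -dualD der_extM.
- have [M hM] := norm_der_ext; exists M => a y _.
  rewrite (le_trans (dual_le_norm _ _))// mulrC.
  by rewrite ler_wpM2r.
Qed.

End IdealDerivation.

(** * Pulling the approximation back to [X], with error bounds *)

Section IdealApproximation.
Variables (R : realType) (A : completeNormedModType R[i]) (mul : A -> A -> A).
Hypothesis bA : banach_algebra mul.
Variable J : set A.
Hypothesis idJ : closed_ideal mul J.
Variables (X : completeNormedModType R[i]).
Variables (lact : A -> X -> X) (ract : X -> A -> X).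
Hypothesis bX : banach_bimodule mul J lact ract.
Variable D : A -> X -> R[i].
Hypothesis derD : cont_derivation mul J lact ract D.
Local Notation K := R[i].
Local Notation sJ := {a : A | J a}.
Local Notation tri := (tri mul J lact ract).
Local Notation ev := (@ev R A mul J X lact ract).
Local Notation ylact := (ytri_lact (lact := lact) (ract := ract) idJ).
Local Notation yract := (ytri_ract (lact := lact) (ract := ract) idJ).

Variables (M L C : K) (xi eta : dual tri -> K) (Mxi Meta : K).
Hypotheses (L0 : 0 <= L) (C0 : 0 <= C).
Hypotheses (Mxi0 : 0 <= Mxi) (Meta0 : 0 <= Meta).
Hypothesis lactL : forall a x, J a -> `|lact a x| <= L * (`|a| * `|x|).
Hypothesis DC : forall a x, J a -> `|D a x| <= C * (`|a| * `|x|).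
Hypotheses (dxi : dual_elt xi) (deta : dual_elt eta).
Hypothesis xiM : forall y, `|xi y| <= Mxi * `|y|.
Hypothesis etaM : forall y, `|eta y| <= Meta * `|y|.
Variables (e : sJ) (b : A) (d1 d2 : K).
Hypotheses (Jb : J b) (d10 : 0 <= d1) (eM : `|sval e| <= M).
Hypotheses (ebd : `|mul (sval e) b - b| <= d2) (bed : `|mul b (sval e) - b| <= d2).
Hypothesis close : forall y : dual tri,
  `|y (der_ext mul J lact ract D b) - (xi (yract y b) - eta (ylact b y))| <= d1 * `|y|.

(** Up to small errors, [D b x] is [D (b e) x = D e (x b) + D b (e x)], and [D b (e x)] is
    [D (e b) (e x)], which is the value of [der_ext b] at [e (x) x (x) e] plus [D e (b e x)].
    Replacing [b e] by [e b] in the last term explains both corrections by [D e], one added to [xi]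
    and one subtracted from [eta]. *)
Lemma pulled_back_approx x :
  `|D b x - ((xi (ev e (ract x b) e) + D (sval e) (ract x b))
     - (eta (ev e (lact b x) e) - D (sval e) (lact (sval e) (lact b x))))|
  <= (d1 * (M * M) + d2 * (C + C * L * M *+ 3 + (Mxi + Meta) * M *+ 2)) * `|x|.
Proof.
pose a := sval e; have Je : J a := svalP e; rewrite -/a.
have M0 : 0 <= M := le_trans (normr_ge0 _) eM.
have d20 : 0 <= d2 := le_trans (normr_ge0 _) ebd.
have comm : `|mul b a - mul a b| <= d2 *+ 2.
  rewrite -(subrKA b) mulr2n (le_trans (ler_normD _ _))// lerD//.
  by rewrite distrC.
have comm' : `|mul a b - mul b a| <= d2 *+ 2 by rewrite distrC.
have d220 : 0 <= d2 *+ 2 by rewrite mulrn_wge0.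
have JB c c' : J c -> J c' -> J (c - c').
  by move=> Jc Jc'; rewrite -scaleN1r; exact: (ideal_lin idJ).
have Jab := ideal_mull idJ a Jb; have Jba := ideal_mull idJ b Je.
have DB c c' z : J c -> J c' -> D (c - c') z = D c z - D c' z.
  by move=> Jc Jc'; rewrite -scaleN1r (der_lin idJ derD)// mulN1r.
have lactB c c' z : J c -> J c' -> lact (c - c') z = lact c z - lact c' z.
  move=> Jc Jc'; rewrite -[- c']scaleN1r (lactDl bX)// ?(lactZl bX)//.
    by rewrite scaleN1r.
  by have [_ _ _ hZ _] := idJ; exact: hZ.
set y := ev e x e.
(* Exact decomposition of the error: the bidual approximation, the module defects of [ev] under [xi]
   and [eta], then the replacements of [b] by [b e] and [e b], and the commutator of [e] and [b]. *)
have -> : D b x - ((xi (ev e (ract x b) e) + D a (ract x b))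
     - (eta (ev e (lact b x) e) - D a (lact a (lact b x)))) =
  (y (der_ext mul J lact ract D b) - (xi (yract y b) - eta (ylact b y)))
  + (- xi (ev e (ract x b) e - yract y b)) + eta (ev e (lact b x) e - ylact b y)
  + (- D (mul b a - b) x) + (- D (mul a b - b) (lact a x))
  + D a (lact (mul b a - mul a b) x).
  rewrite !dual_eltB// !DB// lactB// (dual_eltB _ _ (der_dual_elt derD Je)).
  rewrite (derM derD _ Jb Je) (lactM bX _ Je Jb) evE (der_extE bA idJ bX derD).
  rewrite -/a; ring.
(* One summand for each error term. Commutators cost [2 * d2]; the three copies of [C * L * M] are
   one from [e b - b] and two from the commutator under [D e]. *)
have -> : (d1 * (M * M) + d2 * (C + C * L * M *+ 3 + (Mxi + Meta) * M *+ 2)) * `|x|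
  = d1 * (M * (`|x| * M)) + Mxi * (M * (`|x| * (d2 *+ 2)))
    + Meta * ((d2 *+ 2) * (`|x| * M)) + C * (d2 * `|x|)
    + C * (d2 * (L * (M * `|x|))) + C * (M * (L * ((d2 *+ 2) * `|x|))) by ring.
have ey : `|y| <= M * (`|x| * M).
  rewrite (le_trans (norm_ev _ _ _ _ _ _))// ler_pM// ?mulr_ge0//.
  by rewrite ler_wpM2l.
apply: (le_trans (ler_normD _ _)); apply: lerD; last first.
  rewrite (le_trans (DC _ _))// ler_wpM2l// ler_pM//.
  rewrite (le_trans (lactL _ _))//; first exact: JB.
  by rewrite ler_wpM2l// ler_wpM2r.
apply: (le_trans (ler_normD _ _)); apply: lerD; last first.
  rewrite normrN (le_trans (DC _ _))//; first exact: JB.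
  rewrite ler_wpM2l// ler_pM// (le_trans (lactL _ _))//.
  by rewrite ler_wpM2l// ler_wpM2r.
apply: (le_trans (ler_normD _ _)); apply: lerD; last first.
  rewrite normrN (le_trans (DC _ _))//; first exact: JB.
  by rewrite ler_wpM2l// ler_wpM2r.
apply: (le_trans (ler_normD _ _)); apply: lerD; last first.
  rewrite (le_trans (etaM _))// ler_wpM2l//.
  rewrite (le_trans (ev_lact bA idJ _ _ _ _ _ Jb))// ler_pM// ?mulr_ge0//.
  by rewrite ler_wpM2l.
apply: (le_trans (ler_normD _ _)); apply: lerD; last first.
  rewrite normrN (le_trans (xiM _))// ler_wpM2l//.
  rewrite (le_trans (ev_ract bA idJ _ _ _ _ _ Jb))// ler_pM// ?mulr_ge0//.
  by rewrite ler_wpM2l.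
by rewrite (le_trans (close _))// ler_wpM2l.
Qed.

End IdealApproximation.

(** The order of choices matters: [xi] and [eta] are fixed first, with tolerance [d1] depending on
    [eps] and [M] alone, and only then [e m], fine enough for their norms. The approximating nets
    may thus be unbounded. *)
Lemma approx_semi_amenable_ideal (R : realType) (A : completeNormedModType R[i])
    (mul : A -> A -> A) (J : set A) :
  banach_algebra mul -> approx_semi_amenable mul setT -> closed_ideal mul J ->
  has_bounded_approx_identity mul J -> approx_semi_amenable mul J.
Proof.
move=> bA asa idJ [NJ [e [M [eJM elim]]]] X lact ract bX D derD.
have M0 : 0 <= M.
  by have [m] := dI_inh NJ; exact: le_trans (normr_ge0 _) (eJM m).2.
have [C C0 DC] := der_bound derD.
have [L L0 XL] := bimodule_bound bX.
pose Z := {p : (X -> R[i]) * (X -> R[i]) | dual_elt p.1 /\ dual_elt p.2}.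
(* The finite sets range over [A]; their elements outside [J] impose no condition. *)
pose P b (eps : R[i]) (p : Z) := J b -> forall x,
  `|D b x - ((sval p).1 (ract x b) - (sval p).2 (lact b x))| <= eps * `|x|.
have [||N [z hz]] := @net_of_finite_approx R A Z P.
- move=> b d d' p dd' h Jb x; rewrite (le_trans (h Jb x))//.
  by rewrite ler_wpM2r.
- move=> F eps eps0.
  have [N [xi [eta [xe hl]]]] :=
    asa _ _ _ (ytri_bimodule bA idJ lact ract) _ (der_ext_derivation bA idJ bX derD).
  pose d1 := eps / 2 / (M * M + 1).
  have MM1 : 0 < M * M + 1 by rewrite ltr_wpDl// mulr_ge0.
  have d10 : 0 < d1 by rewrite !divr_gt0.
  have [i0 hi] := eventually_ex (eventually_all (fun b (_ : b \in F) => hl b I d1 d10)).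
  have [dxi deta] := xe i0.
  have [Mxi Mxi0 xiM] := dual_elt_bound dxi.
  have [Meta Meta0 etaM] := dual_elt_bound deta.
  pose c := C + C * L * M *+ 3 + (Mxi + Meta) * M *+ 2.
  have c0 : 0 <= c.
    apply: addr_ge0; last by rewrite mulrn_wge0// mulr_ge0// addr_ge0.
    by apply: addr_ge0 => //; rewrite mulrn_wge0// !mulr_ge0.
  have c1 : 0 < c + 1 by rewrite ltr_wpDl.
  (* [d1] and [d2] each account for half of [eps]; [c] collects the coefficient of [d2] in
     [pulled_back_approx], including the norms of the chosen functionals. *)
  pose d2 := eps / 2 / (c + 1).
  have d20 : 0 < d2 by rewrite !divr_gt0.
  have [m hm] : exists m, forall b, b \in F -> J b ->
      `|mul (e m) b - b| < d2 /\ `|mul b (e m) - b| < d2.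
    apply: eventually_ex; apply: eventually_all => b _.
    have [Jb|nJb] := pselect (J b); last first.
      by have [m0] := dI_inh NJ; exists m0.
    by have [m0 hm0] := elim b Jb d2 d20; exists m0 => m /hm0.
  have [Jem eM] := eJM m; pose em : {a | J a} := exist _ (e m) Jem.
  pose ev x := ev mul lact ract em x em.
  have evl v1 s v2 : ev (v1 + s *: v2) = ev v1 + s *: ev v2 by exact: ev_linm.
  have evb : exists c' : R[i], forall x, `|ev x| <= c' * `|x|.
    exists (`|e m| * `|e m|) => x; rewrite (le_trans (norm_ev _ _ _ _ _ _))//=.
    by rewrite [`|x| * _]mulrC mulrA.
  have dDe := der_dual_elt derD Jem.
  have dxi' : dual_elt (fun x => xi i0 (ev x) + D (e m) x).
    by apply: dual_eltD => //; exact: (dual_elt_comp dxi evl evb).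
  have deta' : dual_elt (fun x => eta i0 (ev x) - D (e m) (lact (e m) x)).
    apply: dual_eltD; first exact: (dual_elt_comp deta evl evb).
    apply: dual_eltN; apply: (dual_elt_comp (h := lact (e m)) dDe).
      by move=> v1 s v2; exact: (lact_linr bX).
    by exists (L * `|e m|) => x; rewrite -mulrA; case: (XL _ x Jem).
  exists (exist _ (_, _) (conj dxi' deta')) => b bF Jb x /=.
  have [h1 h2] := hm b bF Jb.
  have lactL a x' : J a -> `|lact a x'| <= L * (`|a| * `|x'|).
    by move=> Ja; case: (XL a x' Ja).
  have := pulled_back_approx bA bX derD L0 C0 Mxi0 Meta0 lactL DC dxi deta
    xiM etaM (e := em) Jb (ltW d10) eM (ltW h1) (ltW h2) (hi b bF) x.
  move=> /le_trans; apply; rewrite ler_wpM2r// [leRHS]splitr lerD//.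
    rewrite /d1 mulrAC ler_pdivrMr// ler_wpM2l ?lerDl//.
    by rewrite divr_ge0// ltW.
  rewrite -/c /d2 mulrAC ler_pdivrMr// ler_wpM2l ?lerDl//.
  by rewrite divr_ge0// ltW.
- exists N, (fun i => (sval (z i)).1), (fun i => (sval (z i)).2); split.
    by move=> i; exact: (svalP (z i)).
  move=> b Jb eps eps0; have [i0 hi] := hz b eps eps0.
  by exists i0 => i /hi h x; exact: h.
Qed.

Theorem theorem2p13 (R : realType) (A : completeNormedModType R[i])
  (mul : A -> A -> A) :
  banach_algebra mul ->
  approx_semi_amenable mul setT ->
  (has_left_approx_identity mul setT /\ has_right_approx_identity mul setT) /\
  (forall J : set A, closed_ideal mul J ->
     has_bounded_approx_identity mul J -> approx_semi_amenable mul J).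
Proof.
move=> bA asa; split; first split.
- exact: has_left_approx_identity_of_asa.
- exact: has_right_approx_identity_of_asa.
- by move=> J idJ bai; exact: approx_semi_amenable_ideal.
Qed.
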